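(* Let $G$ be a finitely presented group, and let $\{G_i\}$ be a lattice of finite index normal subgroups of $G$ (that is, a collection of finite index normal subgroups such that whenever $G_i$ and $G_j$ are in the collection, so is $G_i\cap G_j$). Then at least one of the following holds: (1) $G_i$ is a (non-trivial) amalgamated free product or an HNN extension for infinitely many $i$; (2) $G$ has Property $(\tau)$ with respect to $\{G_i\}$; (3) the rank gradient of $(G,\{G_i\})$ is zero.
   Context: Rank: for a finitely generated group $H$, $d(H)$ denotes the minimal size of a generating set of $H$. Rank gradient: for a finitely generated group $G$ and a collection $\{G_i\}$ of finite index subgroups, the rank gradient of the pair $(G,\{G_i\})$ is $\inf_i \frac{d(G_i)-1}{[G:G_i]}$. Cheeger constant: for a finite graph $X$ with vertex set $V(X)$, $h(X)=\min\{|\partial A|/|A| : A\subset V(X),\ 0<|A|\le |V(X)|/2\}$, where $\partial A$ is the set of edges joining a vertex in $A$ to a vertex not in $A$. Property $(\tau)$: fix a finite generating set $S$ of $G$, and for a collection $\{G_i\}$ of finite index normal subgroups let $X_i$ be the Cayley graph of $G/G_i$ with respect to the image of $S$. Then $G$ has Property $(\tau)$ with respect to $\{G_i\}$ if the Cheeger constants $h(X_i)$ are bounded away from zero, i.e. there is $\epsilon>0$ with $h(X_i)\ge\epsilon$ for all $i$ (the trivial quotient, for which there is no admissible $A$, imposes no condition). This does not depend on the choice of $S$. Graph of groups terminology: a group is an amalgamated free product if it is isomorphic to $P*_R Q$ with $R$ a proper subgroup of both $P$ and $Q$ (a non-trivial amalgamated free product); it is an HNN extension if it is isomorphic to $P*_R$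 for some group $P$ and subgroup $R\le P$ with an injection $R\to P$. Being one of these two is the same as admitting a non-trivial decomposition as a graph of groups. ''Infinitely many $i$'' means for infinitely many distinct subgroups in the collection. *)

(* Defs.v *)
From HB Require Import structures.
From mathcomp Require Import all_boot all_order all_algebra finmap.
From mathcomp Require Import all_classical all_reals ereal.

Set Implicit Arguments.
Unset Strict Implicit.
Unset Printing Implicit Defensive.

Import Order.TTheory GRing.Theory Num.Theory.

Local Open Scope classical_set_scope.
Local Open Scope quotient_scope.

(** A word in [X] and its formal inverses; [(x, true)] is the letter [x] and
    [(x, false)] is the letter [x^-1]. *)
Definition word (X : Type) : Type := seq (X * bool).
HB.instance Definition _ (X : choiceType) := Choice.on (word X).

Definition inv_word (X : Type) (w : word X) : word X :=
  rev [seq (l.1, ~~ l.2) | l <- w].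

(** The congruence on words whose quotient is <X | Rel>. *)
Inductive word_eq (X : Type) (Rel : set (word X)) : word X -> word X -> Prop :=
| word_eq_refl u : word_eq Rel u u
| word_eq_sym u v : word_eq Rel u v -> word_eq Rel v u
| word_eq_trans u v w : word_eq Rel u v -> word_eq Rel v w -> word_eq Rel u w
| word_eq_cat u u' v v' :
    word_eq Rel u u' -> word_eq Rel v v' -> word_eq Rel (u ++ v) (u' ++ v')
| word_eq_cancel x b : word_eq Rel [:: (x, b); (x, ~~ b)] [::]
| word_eq_rel r : Rel r -> word_eq Rel r [::].

Section Presented.
Variables (X : choiceType) (Rel : set (word X)).

Definition word_eqb (u v : word X) : bool := `[< word_eq Rel u v >].

Lemma word_eqb_refl : reflexive word_eqb.
Proof. by move=> u; apply/asboolP; exact: word_eq_refl. Qed.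

Lemma word_eqb_sym : symmetric word_eqb.
Proof. by move=> u v; apply/asboolP/asboolP; exact: word_eq_sym. Qed.

Lemma word_eqb_trans : transitive word_eqb.
Proof.
move=> v u w /asboolP uv /asboolP vw.
by apply/asboolP; exact: word_eq_trans uv vw.
Qed.

Canonical word_equiv :=
  EquivRel word_eqb word_eqb_refl word_eqb_sym word_eqb_trans.

Definition presented : Type := {eq_quot word_equiv}.
HB.instance Definition _ := Choice.on presented.
HB.instance Definition _ := EqQuotient.on presented.

Definition class_of (w : word X) : presented := \pi_presented w.

Lemma class_ofP u v : class_of u = class_of v <-> word_eq Rel u v.
Proof.
by split=> [/eqmodP/asboolP //|uv]; apply/eqmodP/asboolP.
Qed.

Definition presented_mul (a b : presented) : presented :=
  class_of (repr a ++ repr b).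
Definition presented_one : presented := class_of [::].
Definition presented_inv (a : presented) : presented :=
  class_of (inv_word (repr a)).

Lemma repr_class u : word_eq Rel (repr (class_of u)) u.
Proof. by apply/class_ofP; rewrite /class_of reprK. Qed.

Lemma presented_mulE u v :
  presented_mul (class_of u) (class_of v) = class_of (u ++ v).
Proof. by apply/class_ofP; apply: word_eq_cat; exact: repr_class. Qed.

Lemma class_of_surj (a : presented) : exists u, a = class_of u.
Proof. by exists (repr a); rewrite /class_of reprK. Qed.

Lemma presented_mulA : associative presented_mul.
Proof.
move=> a b c; have [u ->] := class_of_surj a.
have [v ->] := class_of_surj b; have [w ->] := class_of_surj c.
by rewrite !presented_mulE catA.
Qed.

Lemma presented_mul1 : left_id presented_one presented_mul.
Proof. by move=> a; have [u ->] := class_of_surj a; rewrite presented_mulE. Qed.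

Lemma presented_mulr1 : right_id presented_one presented_mul.
Proof.
by move=> a; have [u ->] := class_of_surj a; rewrite presented_mulE cats0.
Qed.

Lemma word_eq_mulV u : word_eq Rel (u ++ inv_word u) [::].
Proof.
elim: u => [|[x b] u IHu]; first exact: word_eq_refl.
rewrite /inv_word /= rev_cons -cats1 -/(inv_word u) catA -cat1s.
apply: word_eq_trans (word_eq_cancel Rel x b).
rewrite -[in X in word_eq _ _ X]cat1s.
apply: (@word_eq_cat _ _ [:: (x, b)]); first exact: word_eq_refl.
rewrite -[X in word_eq _ _ X]cat0s.
by apply: word_eq_cat => //; exact: word_eq_refl.
Qed.

Lemma inv_wordK (u : word X) : inv_word (inv_word u) = u.
Proof.
rewrite /inv_word map_rev revK -map_comp -[RHS]map_id.
by apply: eq_map => -[x b] /=; rewrite negbK.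
Qed.

Lemma presented_mulV : left_inverse presented_one presented_inv presented_mul.
Proof.
move=> a; rewrite /presented_inv /presented_mul; apply/class_ofP.
rewrite -[X in _ ++ X]inv_wordK.
apply: word_eq_trans (word_eq_mulV (inv_word (repr a))).
apply: word_eq_cat; first exact: repr_class.
by rewrite inv_wordK; exact: word_eq_refl.
Qed.

Lemma presented_mulrV : right_inverse presented_one presented_inv presented_mul.
Proof.
move=> a; rewrite /presented_inv /presented_mul; apply/class_ofP.
apply: word_eq_trans (word_eq_mulV (repr a)).
by apply: word_eq_cat; [exact: word_eq_refl|exact: repr_class].
Qed.

HB.instance Definition _ := isGroup.Build presented
  presented_mulA presented_mul1 presented_mulr1 presented_mulV presented_mulrV.

End Presented.

Section Subgroups.
Variable G : groupType.
Local Open Scope group_scope.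

Definition is_subgroup (H : set G) : Prop :=
  [/\ H 1, (forall x y, H x -> H y -> H (x * y)) & (forall x, H x -> H x^-1)].

Definition is_normal (H : set G) : Prop := forall x g, H x -> H (x ^ g).

(** Product of subsets; for [N] normal it is the product of [G/N] on cosets. *)
Definition mulset (A B : set G) : set G := [set x * y | x in A & y in B].

Definition coset_by (H : set G) (g : G) : set G := mulset [set g] H.

Definition cosets (H : set G) : set (set G) := range (coset_by H).

Definition finite_index (H : set G) : Prop := finite_set (cosets H).

(** Meaningful for subgroups of finite index. *)
Definition subgroup_index (H : set G) : nat := #|` fset_set (cosets H)|.

Definition generated (S : set G) : set G :=
  [set x | forall K : set G, is_subgroup K -> S `<=` K -> K x].

(** d(H); meaningful for finitely generated [H]. *)
Definition rank (H : set G) : nat :=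
  xget 0%N [set n | (exists S : {fset G}, generated [set` S] = H /\ #|` S| = n) /\
                    (forall S : {fset G}, generated [set` S] = H -> n <= #|` S|)%N].

End Subgroups.

Definition isomorphic_to (G : groupType) (H : set G) (K : groupType) : Prop :=
  exists f : {multiplicative K -> G}, injective f /\ range f = H.

Definition finitely_presented (G : groupType) : Prop :=
  exists (n : nat) (Rel : set (word 'I_n)),
    finite_set Rel /\ isomorphic_to [set: G] (presented Rel).

Section Splittings.
Variables (P Q R : groupType).
Local Open Scope group_scope.

(** P *_R Q, where [R] is mapped to [P] by [i] and to [Q] by [j]: generators
    P + Q, relators the multiplication tables of [P] and [Q] and
    (i r) (j r)^-1. *)
Inductive amalgam_rel (i : R -> P) (j : R -> Q) : word (P + Q) -> Prop :=
| amalgam_rell p p' :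
    amalgam_rel i j [:: (inl p, true); (inl p', true); (inl (p * p'), false)]
| amalgam_relr q q' :
    amalgam_rel i j [:: (inr q, true); (inr q', true); (inr (q * q'), false)]
| amalgam_relR r : amalgam_rel i j [:: (inl (i r), true); (inr (j r), false)].

(** P *_R, where [R] is mapped to [P] by [i] and by [j]: generators P and a
    stable letter t = [None], relators the multiplication table of [P] and
    t (i r) t^-1 (j r)^-1. *)
Inductive hnn_rel (i j : R -> P) : word (option P) -> Prop :=
| hnn_rell p p' :
    hnn_rel i j [:: (Some p, true); (Some p', true); (Some (p * p'), false)]
| hnn_relR r :
    hnn_rel i j
      [:: (None, true); (Some (i r), true); (None, false); (Some (j r), false)].

End Splittings.

Definition amalgam (P Q R : groupType) (i : R -> P) (j : R -> Q) : groupType :=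
  presented (amalgam_rel i j).

Definition hnn (P R : groupType) (i j : R -> P) : groupType :=
  presented (hnn_rel i j).

Definition is_nontrivial_amalgam (G : groupType) (H : set G) : Prop :=
  exists (P Q R : groupType)
         (i : {multiplicative R -> P}) (j : {multiplicative R -> Q}),
    [/\ injective i, injective j, range i <> [set: P], range j <> [set: Q]
      & isomorphic_to H (amalgam i j)].

Definition is_hnn (G : groupType) (H : set G) : Prop :=
  exists (P R : groupType) (i j : {multiplicative R -> P}),
    [/\ injective i, injective j & isomorphic_to H (hnn i j)].

(** Loops and multiple edges are allowed; [src] and [tgt] orient the edges
    arbitrarily. *)
Record multigraph := Multigraph {
  vtype : choiceType;
  etype : choiceType;
  vertices : set vtype;
  edges : set etype;
  src : etype -> vtype;
  tgt : etype -> vtype }.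

Definition boundary (X : multigraph) (A : {fset vtype X}) : set (etype X) :=
  [set e | edges e /\ (src e \in A) != (tgt e \in A)].

(** For a finite graph this infimum runs over finitely many values, so it is a
    minimum, except that it is +oo if the graph has at most one vertex. *)
Definition cheeger (R : realType) (X : multigraph) : \bar R :=
  ereal_inf [set ((#|` fset_set (boundary A)|%:R / #|` A|%:R)%:E)%R
            | A in [set A : {fset vtype X} |
                    [/\ [set` A] `<=` @vertices X, (0 < #|` A|)%N
                      & (2 * #|` A| <= #|` fset_set (@vertices X)|)%N]]].

(** The Cayley graph of G/N with respect to the image of [S]: the edge [(C, D)],
    with C in G/N and D in the image of S, joins C to C D. *)
Definition cayley_quotient (G : groupType) (S : {fset G}) (N : set G) :
    multigraph :=
  @Multigraph (set G) (set G * set G)%type (cosets N)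
    [set e | cosets N e.1 /\ [set coset_by N s | s in [set` S]] e.2]
    fst (fun e => mulset e.1 e.2).

(** For finitely generated [G] this does not depend on the finite generating
    set, so quantifying over all of them is the same as fixing one. *)
Definition property_tau (R : realType) (G : groupType) (L : set (set G)) :
    Prop :=
  forall S : {fset G}, generated [set` S] = [set: G] ->
    exists eps : R, (0 < eps)%R /\
      forall N, L N -> (eps%:E <= cheeger R (cayley_quotient S N))%E.

Definition rank_gradient (R : realType) (G : groupType) (L : set (set G)) :
    \bar R :=
  ereal_inf [set ((((rank H)%:R - 1) / (subgroup_index H)%:R)%:E)%R | H in L].

Definition normal_lattice (G : groupType) (L : set (set G)) : Prop :=
  (forall H, L H -> [/\ is_subgroup H, is_normal H & finite_index H]) /\
  (forall H K, L H -> L K -> L (H `&` K)).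

(* Main.v *)
From HB Require Import structures.
From mathcomp Require Import all_boot all_order all_algebra all_fingroup finmap.
From mathcomp Require Import all_classical all_reals ereal.
From mathcomp Require Import zify lra.
Require Import Defs.

Set Implicit Arguments.
Unset Strict Implicit.
Unset Printing Implicit Defensive.

Import Order.TTheory GRing.Theory Num.Theory.

Local Open Scope classical_set_scope.
Local Open Scope group_scope.

(** The argument is Lackenby's. Suppose that [G] lacks Property (tau), that only
    finitely many members of [L] split, and that the rank gradient is positive.
    Take [H] in [L] whose ratio (d(H) - 1)/[G:H] is within a factor less than 4/3
    of the infimum. It suffices to find a subgroup [M] of [H] in [L] with
    d(M) - 1 <= (3/4) (d(H) - 1) [H:M] ([descent]): its ratio is below the infimum.

    As (tau) fails, some G/N has a cut that is very sparse; being closed under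
    intersections, [L] contains [M] = [H & N], and the cut of G/N restricts to a
    sparse cut of the Cayley graph of H/M with respect to a smallest generating
    set of [H] ([restrict_sparse_cut]). The index of [M] can be made so large that
    [M] is not one of the finitely many members that split.

    In the Cayley graph of H/M choose a set [A] that realises the Cheeger constant
    and has least size. Then [A] and its complement [B] are connected, and [A] has
    more than a quarter of the vertices ([minimal_large], [minimal_connected],
    [minimal_co_connected]). Let [A'] consist of the vertices within distance [n] of
    [A], where [n] bounds the lengths of the relators of [H]. Every edge and every
    relator loop of the Cayley graph lies in [A'] or in [B], and [A'] has at most
    three quarters of the vertices since the cut is sparse. The group [M] is the
    fundamental group of the covering of the presentation complex whose 1-skeleton
    is this graph, so it is decomposed by [A'] and [B]:
    - if [A' & B] is disconnected, some loop crosses it back and forth, which gives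
      a surjection of [M] onto the integers, so [M] is an HNN extension
      ([disconnected_cut_hnn]);
    - if it is connected, [M] is the amalgam of the images P, Q in [M] of the
      fundamental groups of [A'] and [B] over the image R of that of [A' & B]
      ([connected_cut_amalgam]).
    As [M] does not split, the second case holds and R is all of P or all of Q. So
    [M] is carried by the loops in [B] or in [A'], and a spanning tree bounds its
    rank by (d(H) - 1) W + 1 where W is the number of vertices of that piece, at
    most (3/4) [H:M] ([loops_rank]).

    No complexes appear: words are edge paths, and a homomorphism out of [M] is
    given by a cocycle, that is, by labels on the edges of the Cayley graph that
    multiply to 1 around every short relator ([cocycle_well_defined]). The relators
    of [H] come from the Reidemeister-Schreier rewriting of those of [G]
    ([kernel_presentation]). *)

(** * Words, homomorphisms and subgroups *)

Section Homomorphisms.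
Variables (G K : groupType) (f : {multiplicative G -> K}).

Lemma hom1 : f 1 = 1.
Proof. by apply: (mulgI (f 1)); rewrite -gmulfM !mulg1. Qed.

Lemma homV x : f x^-1 = (f x)^-1.
Proof. by apply: (mulgI (f x)); rewrite -gmulfM !mulgV hom1. Qed.

Lemma hom_inj : (forall x, f x = 1 -> x = 1) -> injective f.
Proof.
by move=> f1 x y fxy; apply/divg1_eq/f1; rewrite gmulfM homV fxy mulgV.
Qed.

Lemma kernel_subgroup : is_subgroup [set g | f g = 1].
Proof.
split=> /= [|x y fx fy|x fx]; first exact: hom1.
- by rewrite gmulfM fx fy mulg1.
- by rewrite homV fx invg1.
Qed.

End Homomorphisms.

Lemma kernel_normal (G K : groupType) (f : {multiplicative G -> K}) :
  is_normal [set g | f g = 1].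
Proof.
by move=> x g /= fx; rewrite conjgE !gmulfM homV fx mul1g mulVg.
Qed.

(** Maps are shown to be multiplicative inside proofs, so they are packed here. *)
Lemma exists_hom (G K : groupType) (f : G -> K) :
  {morph f : x y / x * y} -> exists h : {multiplicative G -> K}, h =1 f.
Proof.
move=> fM; pose m := isMultiplicative.Build G K f fM.
by exists (HB.pack_for {multiplicative G -> K} f m).
Qed.

Section Evaluation.
Variables (X : Type) (G : groupType) (e : X -> G).

Definition letter_value (l : X * bool) : G := if l.2 then e l.1 else (e l.1)^-1.

Definition ev (w : word X) : G := foldr (fun l g => letter_value l * g) 1 w.

Lemma ev_cons l w : ev (l :: w) = letter_value l * ev w.
Proof. by []. Qed.

Lemma ev_cat u v : ev (u ++ v) = ev u * ev v.
Proof.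
by elim: u => [|l u IHu]; rewrite ?mul1g // cat_cons !ev_cons IHu mulgA.
Qed.

Lemma letter_valueN l : letter_value (l.1, ~~ l.2) = (letter_value l)^-1.
Proof. by case: l => x []; rewrite /letter_value ?invgK. Qed.

Lemma inv_word_cons (l : X * bool) w :
  inv_word (l :: w) = inv_word w ++ [:: (l.1, ~~ l.2)].
Proof. by rewrite /inv_word /= rev_cons -cats1. Qed.

Lemma size_inv_word (w : word X) : size (inv_word w) = size w.
Proof. by rewrite size_rev size_map. Qed.

Lemma ev_inv w : ev (inv_word w) = (ev w)^-1.
Proof.
elim: w => [|l w IHw]; first by rewrite /= invg1.
by rewrite inv_word_cons ev_cat IHw ev_cons /= letter_valueN mulg1 invgM.
Qed.

Lemma ev_word_eq (Rel : set (word X)) u v :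
  (forall r, Rel r -> ev r = 1) -> word_eq Rel u v -> ev u = ev v.
Proof.
move=> Rel1; elim=> {u v} //.
- by move=> u v w _ -> _ ->.
- by move=> u u' v v' _ evu _ evv; rewrite !ev_cat evu evv.
- by move=> x b; rewrite /= (letter_valueN (x, b)) mulg1 mulgV.
Qed.

Lemma range_ev_subgroup : is_subgroup (range ev).
Proof.
split; first by exists [::].
- by move=> _ _ [u _ <-] [v _ <-]; exists (u ++ v); rewrite ?ev_cat.
- by move=> _ [u _ <-]; exists (inv_word u); rewrite ?ev_inv.
Qed.

Lemma ev_in (K : set G) w :
  is_subgroup K -> (forall x, K (e x)) -> K (ev w).
Proof.
move=> [K1 KM KV] Ke; elim: w => [|[x b] w IHw] //; rewrite ev_cons.
by apply: KM => //; case: b; rewrite /letter_value /=; [|apply: KV].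
Qed.

End Evaluation.

Lemma ev_hom (X : Type) (G K : groupType) (e : X -> G)
    (f : {multiplicative G -> K}) w : f (ev e w) = ev (f \o e) w.
Proof.
elim: w => [|[x b] w IHw]; rewrite ?hom1 // !ev_cons gmulfM IHw.
by case: b; rewrite /letter_value /= ?homV.
Qed.

Lemma eq_ev (X : Type) (G : groupType) (e e' : X -> G) w :
  e =1 e' -> ev e w = ev e' w.
Proof. by move=> ee; elim: w => [|[x b] w IHw] //=; rewrite IHw /letter_value ee. Qed.

Section Generation.
Variable G : groupType.

Lemma generated_subgroup (S : set G) : is_subgroup (generated S).
Proof.
split=> [K [] //|x y Sx Sy K sK SK|x Sx K sK SK].
- by case: (sK) => _ KM _; apply: KM; [apply: Sx|apply: Sy].
- by case: (sK) => _ _ KV; exact: KV (Sx _ sK SK).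
Qed.

Lemma sub_generated (S : set G) : S `<=` generated S.
Proof. by move=> x Sx K _; apply. Qed.

Lemma generated_range (X : Type) (e : X -> G) : generated (range e) = range (ev e).
Proof.
apply/seteqP; split=> g.
- move=> eg; apply: (eg (range (ev e))); first exact: range_ev_subgroup.
  by move=> _ [x _ <-]; exists [:: (x, true)]; rewrite ?mulg1 //= mulg1.
- move=> [w _ <-]; apply: (@ev_in _ _ _ (generated (range e))).
    exact: generated_subgroup.
  by move=> x; apply: sub_generated; exists x.
Qed.

Lemma range_fset_val (S : {fset G}) : range (val : S -> G) = [set` S].
Proof.
apply/seteqP; split=> [_ [x _ <-]|x Sx] /=; first exact: valP.
by exists [` Sx]%fset.
Qed.

Lemma rank_le (H : set G) (S : {fset G}) :
  generated [set` S] = H -> (rank H <= #|` S|)%N.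
Proof.
move=> SH; rewrite /rank; case: xgetP => [_ -> [_ /(_ S SH)] //|_].
by [].
Qed.

Lemma rank_attained (H : set G) (S : {fset G}) :
  generated [set` S] = H ->
  exists T : {fset G}, generated [set` T] = H /\ #|` T| = rank H.
Proof.
move=> SH; pose P n := `[< exists T : {fset G}, generated [set` T] = H /\ #|` T| = n >].
have exP : exists n, P n by exists #|` S|; apply/asboolP; exists S.
case: (ex_minnP exP) => n /asboolP Pn minP.
rewrite /rank; case: xgetP => [m -> [] //|none]; case: (none n); split=> // T TH.
by apply: minP; apply/asboolP; exists T.
Qed.

End Generation.

(** The proof that [H] is a subgroup is an argument of the predicate, so that the
    group structure can be found from the type alone. *)
Section SubgroupType.
Variables (G : groupType) (H : set G) (sH : is_subgroup H).

Definition subgroup_pred of is_subgroup H : pred G := fun g => `[< H g >].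
Definition subgroup_type : Type := {g : G | subgroup_pred sH g}.

HB.instance Definition _ := Choice.on subgroup_type.
HB.instance Definition _ : isSub G (subgroup_pred sH) subgroup_type :=
  SubType.on subgroup_type.

Lemma subgroup_pred_closed : group_closed (subgroup_pred sH).
Proof.
case: (sH) => H1 HM HV; split; first exact/asboolP.
by move=> x y /asboolP Hx /asboolP Hy; apply/asboolP/HM => //; apply: HV.
Qed.

HB.instance Definition _ :=
  SubChoice_isSubGroup.Build G (subgroup_pred sH) subgroup_type
    subgroup_pred_closed.

End SubgroupType.

(** * Presentations, cocycles and maps onto the integers *)

Section PresentedGroup.
Variables (X : choiceType) (Rel : set (word X)).
Local Notation cls := (class_of Rel).

Lemma class_ofM u v : cls (u ++ v) = cls u * cls v.
Proof. by rewrite -presented_mulE. Qed.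

Lemma class_of_inv u : cls (inv_word u) = (cls u)^-1.
Proof.
apply: (mulgI (cls u)); rewrite -class_ofM mulgV.
by apply/class_ofP/word_eq_mulV.
Qed.

Lemma class_of_ev w : cls w = ev (fun x => cls ([:: (x, true)])) w.
Proof.
elim: w => [|[x b] w IHw] //; rewrite -cat1s class_ofM ev_cons IHw.
by case: b => //; rewrite /letter_value /= -class_of_inv.
Qed.

Lemma presented_hom (K : groupType) (f : X -> K) :
  (forall r, Rel r -> ev f r = 1) ->
  exists h : {multiplicative presented Rel -> K}, forall w, h (cls w) = ev f w.
Proof.
move=> f1; pose h (a : presented Rel) := ev f (generic_quotient.repr a).
have hE w : h (cls w) = ev f w by apply: (ev_word_eq f1); exact: repr_class.
have [|k kE] := @exists_hom (presented Rel) K h.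
  move=> a b; have [u ->] := class_of_surj a; have [v ->] := class_of_surj b.
  by rewrite -class_ofM !hE ev_cat.
by exists k => w; rewrite kE hE.
Qed.

End PresentedGroup.

(** A cocycle on the Cayley graph of [Q] labels the edge from [x] to [x * f s] by
    [c x s]; a path is worth the product of its labels. When relators have trivial
    labels at every starting vertex this depends only on the group element that
    the path represents. *)
Section Cocycle.
Variables (X : Type) (Q K : groupType) (f : X -> Q) (c : Q -> X -> K).

Definition cocycle_letter (x : Q) (l : X * bool) : K :=
  if l.2 then c x l.1 else (c (x * (f l.1)^-1) l.1)^-1.

Fixpoint cocycle (x : Q) (w : word X) : K :=
  if w is l :: w' then cocycle_letter x l * cocycle (x * letter_value f l) w'
  else 1.

Lemma cocycle_cat x u v :
  cocycle x (u ++ v) = cocycle x u * cocycle (x * ev f u) v.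
Proof.
elim: u x => [|l u IHu] x; first by rewrite mulg1 mul1g.
by rewrite cat_cons [LHS]/= IHu /= !mulgA.
Qed.

Lemma cocycle_word_eq (Rel : set (word X)) u v :
  (forall r, Rel r -> ev f r = 1) ->
  (forall r x, Rel r -> cocycle x r = 1) ->
  word_eq Rel u v -> forall x, cocycle x u = cocycle x v.
Proof.
move=> f1 c1; elim=> {u v} //.
- by move=> u v w _ uv _ vw x; rewrite uv vw.
- move=> u u' v v' uu' cuu' _ cvv' x.
  by rewrite !cocycle_cat cuu' cvv' (ev_word_eq f1 uu').
- move=> y b x; rewrite /= mulg1 /cocycle_letter /=.
  by case: b; rewrite /letter_value /= ?mulgK ?mulgV ?mulVg ?mulgVK.
- by move=> r r1 x; exact: c1.
Qed.

End Cocycle.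

(** Cocycles take values in groups written multiplicatively. *)
Definition zgroup : Type := int.
HB.instance Definition _ := Choice.on zgroup.
HB.instance Definition _ := isGroup.Build zgroup
  (@addrA int) (@add0r int) (@addr0 int) (@addNr int) (@addrN int).

(** The extension is the semidirect product of the kernel of [chi] with the infinite
    cyclic group generated by [t]; both associated subgroups are the whole kernel. *)
Lemma hnn_of_map_onto_Z (G : groupType) (N : set G) (chi : G -> int) (t : G) :
  is_subgroup N ->
  (forall m n, N m -> N n -> chi (m * n) = (chi m + chi n)%R) ->
  N t -> chi t = 1%R -> is_hnn N.
Proof.
move=> [N1 NM NV] chiM Nt chit.
have chi1 : chi 1 = 0%R.
  by apply: (addrI (chi 1)); rewrite -chiM // mulg1 addr0.
have chiV n : N n -> chi n^-1 = (- chi n)%R.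
  by move=> Nn; apply: (addrI (chi n)); rewrite -chiM ?mulgV ?subrr //; exact: (NV).
have NX k : N (t ^+ k) by elim: k => [|k IHk] //; rewrite expgS; exact: (NM).
have chiX k : chi (t ^+ k) = Posz k.
  elim: k => [|k IHk]; first by rewrite expg0 chi1.
  by rewrite expgS chiM // chit IHk -addn1 addnC PoszD.
have sK : is_subgroup [set n | N n /\ chi n = 0%R].
  split=> /= [|x y [Nx x0] [Ny y0]|x [Nx x0]]; first by split.
  - by split; [exact: (NM)|rewrite chiM // x0 y0 addr0].
  - by split; [exact: (NV)|rewrite chiV // x0 oppr0].
pose P : groupType := subgroup_type sK.
have PK (p : P) : N (val p) /\ chi (val p) = 0%R by exact/asboolP/(valP p).
have toP g : N g -> chi g = 0%R -> exists p : P, val p = g.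
  move=> Ng g0; have Kg : subgroup_pred sK g by apply/asboolP.
  by exists (Sub g Kg); rewrite SubK.
have conjP (p : P) : exists p' : P, val p' = t * val p * t^-1.
  have [Np p0] := PK p; apply: toP; first by apply: (NM); [exact: (NM)|exact: (NV)].
  rewrite !chiM ?chiV ?p0 ?chit ?addr0 ?subrr //; [exact: (NM)|exact: (NV)].
have [j0 j0E] := choice conjP.
have [j jE] : exists j : {multiplicative P -> P}, j =1 j0.
  apply: exists_hom => p p'; apply: val_inj; rewrite valM !j0E valM.
  by rewrite !mulgA mulgVK.
have [i iE] : exists i : {multiplicative P -> P}, i =1 id by exact: exists_hom.
have {j0E}jE p : val (j p) = t * val p * t^-1 by rewrite jE j0E.
pose f (x : option P) : G := if x is Some p then val p else t.
have [|h hE] := @presented_hom _ (hnn_rel i j) G f.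
  move=> _ [p p'|r].
  - change (val p * (val p' * ((val (p * p'))^-1 * 1)) = 1).
    by rewrite mulg1 valM mulgA mulgV.
  - change (t * (val (i r) * (t^-1 * ((val (j r))^-1 * 1))) = 1).
    by rewrite jE iE !invgM !invgK mulg1 !mulgA mulgVK mulgK mulgV.
exists P, P, i, j; split.
- by move=> p p'; rewrite !iE.
- move=> p p' /(congr1 val); rewrite !jE => /mulIg/mulgI; exact: val_inj.
pose T : presented (hnn_rel i j) := class_of _ [:: (None, true)].
pose I p : presented (hnn_rel i j) := class_of _ [:: (Some p, true)].
have IM p p' : I p * I p' = I (p * p').
  have /class_ofP := word_eq_rel (hnn_rell i j p p'); rewrite !class_of_ev => pp'.
  have {pp'} : I p * (I p' * ((I (p * p'))^-1 * 1)) = 1 by exact: pp'.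
  by rewrite mulg1 mulgA => /divg1_eq.
have IT p : T * I p = I (j p) * T.
  have /class_ofP := word_eq_rel (hnn_relR i j p); rewrite !class_of_ev => tp.
  have {tp} : T * (I (i p) * (T^-1 * ((I (j p))^-1 * 1))) = 1 by exact: tp.
  by rewrite mulg1 !mulgA iE => /divg1_eq <-; rewrite mulgVK.
have TI p : exists p', T^-1 * I p = I p' * T^-1.
  have [p' p'E] : exists p', j p' = p.
    have [Np p0] := PK p.
    have [||p' p'E] := toP (t^-1 * val p * t).
    - by apply: (NM) => //; apply: (NM) => //; apply: (NV).
    - rewrite !chiM ?chiV ?p0 ?chit ?addr0 ?addNr //; [exact: (NV)|].
      by apply: (NM) => //; apply: (NV).
    by exists p'; apply: val_inj; rewrite jE p'E !mulgA mulgV mul1g mulgK.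
  by exists p'; rewrite -p'E; apply: (mulgI T); rewrite mulVKg mulgA IT mulgK.
have I1 : I 1 = 1 by apply: (mulgI (I 1)); rewrite IM !mulg1.
have hI p : h (I p) = val p by rewrite hE /= /letter_value /= mulg1.
have hT : h T = t by rewrite hE /= /letter_value /= mulg1.
have hX k : h (T ^+ k) = t ^+ k.
  by elim: k => [|k IHk]; rewrite ?hom1 // !expgS gmulfM IHk hT.
(* Moving the stable letters to the right normalises every element. *)
have normal_form a : exists p m k, a * T ^+ m = I p * T ^+ k.
  have [w ->] := class_of_surj a; elim: w => [|[[q|] b] w [p [m [k IHw]]]].
  - by exists 1, 0%N, 0%N; rewrite I1.
  - rewrite -cat1s class_ofM.
    have -> : class_of (hnn_rel i j) [:: (Some q, b)] = I (if b then q else q^-1).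
      case: b => //; rewrite -[LHS]/(class_of _ (inv_word [:: (Some q, true)])).
      by rewrite class_of_inv; apply: mulg1_eq; rewrite IM mulgV I1.
    by exists ((if b then q else q^-1) * p), m, k; rewrite -mulgA IHw mulgA IM.
  - rewrite -cat1s class_ofM; case: b; rewrite -/T.
      by exists (j p), m, k.+1; rewrite -mulgA IHw mulgA IT -mulgA expgS.
    have -> : class_of (hnn_rel i j) [:: (None, false)] = T^-1.
      by rewrite -class_of_inv.
    have [p' p'E] := TI p; exists p', m.+1, k.
    by rewrite expgSr -mulgA (mulgA _ _ T) IHw !mulgA p'E -!mulgA -expgSr expgS mulKg.
exists h; split.
- apply: hom_inj => a ha1; have [p [m [k amk]]] := normal_form a.
  have := congr1 h amk; rewrite !gmulfM ha1 mul1g hI !hX => tmk.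
  have [Np p0] := PK p.
  have mk : m = k by have := congr1 chi tmk; rewrite chiM // !chiX p0 add0r => -[].
  move: tmk; rewrite mk -{1}[t ^+ k]mul1g => /mulIg p1.
  have {}p1 : p = 1 by apply: val_inj; rewrite -p1 hom1.
  by move: amk; rewrite mk p1 I1 => /mulIg.
- apply/seteqP; split=> [_ [a _ <-]|n Nn].
    have [w ->] := class_of_surj a; rewrite hE; apply: ev_in => // -[p|] //=.
    by case: (PK p).
  pose m := `|chi n|%N; have chiE : chi n = Posz m \/ chi n = (- Posz m)%R.
    by rewrite /m; case: (chi n) => k; [left|right; rewrite NegzE].
  have NnX k : N (n * t ^+ k) by exact: (NM).
  case: chiE => chin.
    have [||p pE] := toP (n * (t ^+ m)^-1); first by apply: (NM) => //; exact: (NV).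
      by rewrite chiM ?chiV ?chiX ?chin ?subrr //; exact: (NV).
    by exists (I p * T ^+ m) => //; rewrite gmulfM hI hX pE mulgVK.
  have [||p pE] := toP (n * t ^+ m) => //.
    by rewrite chiM // chiX chin addNr.
  by exists (I p * (T ^+ m)^-1) => //; rewrite gmulfM homV hI hX pE mulgK.
Qed.

(** * Finite quotients and finite presentations of subgroups of finite index *)

Lemma bounded_on_fin (T : finType) (F : T -> nat) :
  exists n, forall x, (F x <= n)%N.
Proof. by exists (\max_x F x) => x; exact: leq_bigmax. Qed.

Lemma bounded_on_finite_set (T : choiceType) (A : set T) (F : T -> nat) :
  finite_set A -> exists n, forall x, A x -> (F x <= n)%N.
Proof.
move=> /finite_seqP [s ->]; exists (\max_(x <- s) F x) => x /= xs.
by rewrite (big_rem x) //= leq_maxl.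
Qed.

(** The group [G/N] is carried by the set of cosets that defines the index. *)
Section Quotient.
Variables (G : groupType) (N : set G).
Hypotheses (sN : is_subgroup N) (nN : is_normal N) (fN : finite_index N).

Lemma coset_by_eq x y : coset_by N x = coset_by N y <-> N (x^-1 * y).
Proof.
case: (sN) => N1 NM NV; split=> [xy|Nxy].
  have : coset_by N x y by rewrite xy; exists y => //; exists 1 => //; rewrite mulg1.
  by move=> [_ ->] [n Nn <-]; rewrite mulKg.
apply/seteqP; split=> _ [_ -> [n Nn <-]].
- exists y => //; exists ((x^-1 * y)^-1 * n); first by apply: (NM) => //; exact: NV.
  by rewrite invgM invgK !mulgA mulgV mul1g.
- exists x => //; exists ((x^-1 * y) * n); first exact: NM.
  by rewrite !mulgA mulgV mul1g.
Qed.

Definition quotient_type of is_subgroup N & is_normal N & finite_index N : Type :=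
  fset_set (cosets N).
Local Notation Q := (quotient_type sN nN fN).
HB.instance Definition _ := Finite.on Q.

Lemma in_cosets x : coset_by N x \in fset_set (cosets N).
Proof. by rewrite in_fset_set // inE; exists x. Qed.

Definition quotient_map (x : G) : Q := [` in_cosets x]%fset.

Lemma quotient_map_eq x y : quotient_map x = quotient_map y <-> N (x^-1 * y).
Proof.
rewrite -coset_by_eq; split=> [/(congr1 val)//|xy]; exact: val_inj.
Qed.

Lemma quotient_map_surj (c : Q) : exists x, quotient_map x = c.
Proof.
have := valP c; rewrite in_fset_set // inE => -[x _ xc].
by exists x; apply: val_inj.
Qed.

Definition quotient_lift (c : Q) : G := projT1 (cid (quotient_map_surj c)).

Lemma quotient_liftK c : quotient_map (quotient_lift c) = c.
Proof. exact: projT2 (cid (quotient_map_surj c)). Qed.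

Definition quotient_mul (c d : Q) : Q :=
  quotient_map (quotient_lift c * quotient_lift d).
Definition quotient_one : Q := quotient_map 1.
Definition quotient_inv (c : Q) : Q := quotient_map (quotient_lift c)^-1.

Lemma quotient_mulE x y :
  quotient_mul (quotient_map x) (quotient_map y) = quotient_map (x * y).
Proof.
case: (sN) => N1 NM NV; apply/quotient_map_eq.
have [/quotient_map_eq Nx /quotient_map_eq Ny] :=
  (quotient_liftK (quotient_map x), quotient_liftK (quotient_map y)).
set x' := quotient_lift _ in Nx *; set y' := quotient_lift _ in Ny *.
have -> : (x' * y')^-1 * (x * y) = (x'^-1 * x) ^ y' * (y'^-1 * y).
  by rewrite conjgE invgM !mulgA mulgK.
by apply: (NM) => //; exact: nN.
Qed.

Lemma quotient_mulA : associative quotient_mul.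
Proof.
move=> a b c; have [x <-] := quotient_map_surj a.
have [y <-] := quotient_map_surj b; have [z <-] := quotient_map_surj c.
by rewrite !quotient_mulE mulgA.
Qed.

Lemma quotient_mul1 : left_id quotient_one quotient_mul.
Proof. by move=> a; have [x <-] := quotient_map_surj a; rewrite quotient_mulE mul1g. Qed.

Lemma quotient_mulV : left_inverse quotient_one quotient_inv quotient_mul.
Proof.
by move=> a; rewrite -{2}[a]quotient_liftK quotient_mulE mulVg.
Qed.

HB.instance Definition _ := Finite_isGroup.Build Q
  quotient_mulA quotient_mul1 quotient_mulV.

End Quotient.

Lemma exists_quotient (G : groupType) (N : set G) :
  is_subgroup N -> is_normal N -> finite_index N ->
  exists (Q : finGroupType) (q : {multiplicative G -> Q}),
    (forall x, exists g, q g = x) /\ (forall g, N g <-> q g = 1).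
Proof.
move=> sN nN fN; exists (quotient_type sN nN fN : finGroupType).
have [|q qE] := @exists_hom G (quotient_type sN nN fN) (quotient_map sN nN fN).
  by move=> x y; rewrite -[RHS]/(quotient_mul _ _) quotient_mulE.
exists q; split=> [x|g]; first by have [g <-] := quotient_map_surj x; exists g.
rewrite qE; split=> [Ng|].
- apply/esym; rewrite -[1]/(quotient_map sN nN fN 1); apply/quotient_map_eq.
  by rewrite invg1 mul1g.
- move/esym; rewrite -[1]/(quotient_map sN nN fN 1) => /quotient_map_eq.
  by rewrite invg1 mul1g.
Qed.

Lemma subgroup_index_card (G : groupType) (N : set G) (T : finType) (F : G -> T) :
  is_subgroup N -> (forall x, exists g, F g = x) ->
  (forall g h, F g = F h <-> N (g^-1 * h)) ->
  finite_index N /\ subgroup_index N = #|T|.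
Proof.
move=> sN Fsurj FN; have [s sK] := choice Fsurj.
pose k x := coset_by N (s x).
have kinj : injective k by move=> x y /(coset_by_eq sN)/FN; rewrite !sK.
have kE : cosets N = [set` [fset k x | x : T]%fset].
  apply/seteqP; split=> [_ [g _ <-]|_ /= /imfsetP [x _ ->]]; last by exists (s x).
  apply/imfsetP; exists (F g) => //.
  by apply/(coset_by_eq sN)/FN; rewrite sK.
split; first by rewrite /finite_index kE; exact: finite_fset.
by rewrite /subgroup_index kE set_fsetK card_imfset // -cardE.
Qed.

Lemma kernel_finite_index (G : groupType) (Q : finGroupType)
    (q : {multiplicative G -> Q}) : finite_index [set g | q g = 1].
Proof.
set N := [set g | q g = 1]; have sN : is_subgroup N := kernel_subgroup q.
pose c x := coset_by N (xget 1 [set g | q g = x]).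
rewrite /finite_index; have -> : cosets N = c @` range q.
  apply/seteqP; split=> [_ [g _ <-]|_ [_ [g _ <-] <-]]; last by eexists.
  exists (q g); first by exists g.
  apply/(coset_by_eq sN); rewrite /N /= gmulfM homV.
  by case: xgetP => [y _ /= ->|/(_ g)[]]; rewrite ?mulVg.
by apply: finite_image; exact: finite_finset.
Qed.

(** Schreier's generators: for a transversal [s] of the kernel, the elements
    [s x * e y * (s (x * q (e y)))^-1] telescope along words. *)
Lemma kernel_finitely_generated (X : finType) (G : groupType) (e : X -> G)
    (Q : finGroupType) (q : {multiplicative G -> Q}) :
  (forall g, exists w, ev e w = g) -> (forall x, exists g, q g = x) ->
  exists S : {fset G}, generated [set` S] = [set g | q g = 1].
Proof.
move=> egen qsurj.
have [s0 s0K] := choice qsurj; pose s (x : Q) := if x == 1 then 1 else s0 x.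
have sK x : q (s x) = x by rewrite /s; case: eqP => [->|]; rewrite ?hom1.
have s1 : s 1 = 1 by rewrite /s eqxx.
pose gam (i : Q * X) := s i.1 * e i.2 * (s (i.1 * q (e i.2)))^-1.
pose S := [fset gam i | i : Q * X]%fset; exists S.
have sS := generated_subgroup [set` S]; case: (sS) => S1 SM SV.
have Sgam x l : generated [set` S]
    (s x * letter_value e l * (s (x * q (letter_value e l)))^-1).
  have Si i : generated [set` S] (gam i).
    by apply: sub_generated => /=; apply/imfsetP; exists i.
  case: l => y []; rewrite /letter_value /=; first exact: (Si (x, y)).
  have := SV _ (Si (x * q (e y)^-1, y)); rewrite /gam /= !invgM !invgK mulgA.
  by rewrite homV mulgVK.
apply/seteqP; split=> g /=.
- move=> Sg; apply: (Sg [set g | q g = 1]) => [|_ /= /imfsetP [i _ ->]].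
    exact: kernel_subgroup.
  by rewrite /gam !gmulfM homV !sK mulgV.
- have [w <-] := egen g => qw.
  suff Sw x : generated [set` S] (s x * ev e w * (s (x * q (ev e w)))^-1).
    by have := Sw 1; rewrite qw mulg1 s1 invg1 mulg1 mul1g.
  elim: w x {qw} => [|l w IHw] x; first by rewrite hom1 !mulg1 mulgV.
  have := SM _ _ (Sgam x l) (IHw (x * q (letter_value e l))).
  by rewrite ev_cons gmulfM !mulgA mulgVK.
Qed.

(** For a finitely presented group and [n] large these are defining relators, for
    any choice of finite generating family. *)
Definition short_relators (X : Type) (G : groupType) (e : X -> G) (n : nat) :
  set (word X) := [set r | (size r <= n)%N /\ ev e r = 1].

Section SubgroupPresentation.
Variables (X0 X : finType) (G H : groupType) (e0 : X0 -> G) (e : X -> H).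
Variables (Rel0 : set (word X0)) (Q : finGroupType).
Variables (q : {multiplicative G -> Q}) (i : {multiplicative H -> G}).
Hypotheses (finRel0 : finite_set Rel0) (Rel01 : forall r, Rel0 r -> ev e0 r = 1).
Hypothesis Rel0_presents : forall w, ev e0 w = 1 -> word_eq Rel0 w [::].
Hypothesis e0_gen : forall g, exists w, ev e0 w = g.
Hypothesis q_surj : forall x, exists g, q g = x.
Hypotheses (i_inj : injective i) (i_range : forall g, q g = 1 -> exists h, i h = g).
Hypotheses (qi : forall h, q (i h) = 1).
Hypothesis e_gen : forall h, exists w, ev e w = h.

(** Reidemeister and Schreier, together with the change of generators. A word over
    [X0] is rewritten, along a transversal, as a word over [X]. This sends the
    relators of [G] to finitely many relators of [H]; the remaining relators that
    are needed say that each generator of [H], written over [X0] and rewritten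
    back, is itself. *)
Lemma kernel_presentation :
  exists n, (0 < n)%N /\
    forall w, ev e w = 1 -> word_eq (short_relators e n) w [::].
Proof.
have [s0 s0K] := choice q_surj; pose s (x : Q) := if x == 1 then 1 else s0 x.
have sK x : q (s x) = x by rewrite /s; case: eqP => [->|]; rewrite ?hom1.
have s1 : s 1 = 1 by rewrite /s eqxx.
pose f x := q (e0 x).
have qev w : q (ev e0 w) = ev f w by exact: ev_hom.
have schreier (j : Q * X0) :
    exists v : word X, i (ev e v) = s j.1 * e0 j.2 * (s (j.1 * f j.2))^-1.
  have [|h <-] := @i_range (s j.1 * e0 j.2 * (s (j.1 * f j.2))^-1).
    by rewrite gmulfM homV gmulfM !sK mulgV.
  by have [v <-] := e_gen h; exists v.
have [b bE] := choice schreier.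
have [a aE] := choice (fun x => e0_gen (i (e x))).
pose al (l : X * bool) := if l.2 then a l.1 else inv_word (a l.1).
have alE l : ev e0 (al l) = i (letter_value e l).
  by case: l => x []; rewrite /al /letter_value /= ?ev_inv aE ?homV.
pose rl x (l : X0 * bool) : word X :=
  if l.2 then b (x, l.1) else inv_word (b (x * (f l.1)^-1, l.1)).
pose fix rw x (w : word X0) : word X :=
  if w is l :: w' then rl x l ++ rw (x * letter_value f l) w' else [::].
have rlE x l : i (ev e (rl x l)) =
    s x * letter_value e0 l * (s (x * letter_value f l))^-1.
  case: l => y []; rewrite /rl /letter_value /= ?bE //.
  by rewrite ev_inv homV bE /= !invgM !invgK mulgVK mulgA.
have rwE x w : i (ev e (rw x w)) = s x * ev e0 w * (s (x * ev f w))^-1.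
  elim: w x => [|l w IHw] x; first by rewrite /= hom1 !mulg1 mulgV.
  by rewrite /= ev_cat gmulfM rlE IHw !mulgA mulgVK.
have [n1 n1P] : exists n, forall r, Rel0 r -> (\max_x size (rw x r) <= n)%N.
  exact: bounded_on_finite_set.
pose loop (l : X * bool) := (l.1, ~~ l.2) :: rw 1 (al l).
have [n2 n2P] := bounded_on_fin (fun l => size (loop l)).
pose n := (maxn n1 n2).+1; exists n; split=> //; set Rel := short_relators e n.
pose K := presented Rel.
pose c x y : K := class_of Rel (b (x, y)).
have cE x w : cocycle f c x w = class_of Rel (rw x w).
  elim: w x => [|[y d] w IHw] x //=; rewrite class_ofM IHw; congr (_ * _).
  by case: d; rewrite /cocycle_letter /rl /= ?class_of_inv.
have short r : (size r <= n)%N -> ev e r = 1 -> class_of Rel r = 1.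
  by move=> rn r1; apply/class_ofP/word_eq_rel.
have f1 r : Rel0 r -> ev f r = 1 by move=> /Rel01 r1; rewrite -qev r1 hom1.
have c1 r x : Rel0 r -> cocycle f c x r = 1.
  move=> Rr; rewrite cE; apply: short.
    by rewrite ltnW // ltnS leq_max (leq_trans _ (n1P r Rr)) // (leq_bigmax x).
  by apply: i_inj; rewrite rwE Rel01 // f1 // !mulg1 mulgV hom1.
have letterE l : class_of Rel [:: l] = cocycle f c 1 (al l).
  have /(short _) : (size (loop l) <= n)%N by rewrite ltnW // ltnS leq_max n2P orbT.
  rewrite cE /loop -cat1s class_ofM => l1.
  have -> : class_of Rel [:: l] = (class_of Rel [:: (l.1, ~~ l.2)])^-1.
    by case: l {l1} => x d; rewrite -class_of_inv /= /inv_word /= negbK.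
  apply: mulg1_eq; apply: l1; apply: i_inj.
  rewrite ev_cat gmulfM rwE -qev alE qi /= !mulg1 letter_valueN homV.
  by rewrite s1 invg1 mul1g mulg1 mulVg hom1.
pose aw (w : word X) : word X0 := flatten (map al w).
have awE w : ev e0 (aw w) = i (ev e w).
  by elim: w => [|l w IHw]; rewrite ?hom1 //= ev_cat alE IHw gmulfM.
have wE w : class_of Rel w = cocycle f c 1 (aw w).
  elim: w => [|l w IHw] //; rewrite -cat1s class_ofM letterE IHw /=.
  by rewrite cocycle_cat -qev alE qi mulg1.
move=> w w1; apply/class_ofP; rewrite wE -[RHS]/(cocycle f c 1 [::]).
apply: (cocycle_word_eq f1 c1); apply: Rel0_presents.
by rewrite awE w1 hom1.
Qed.

End SubgroupPresentation.

(** * Walks and connected sets in Cayley graphs *)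

Section Walks.
Variables (X : finType) (Q : finGroupType) (f : X -> Q).
Implicit Types (W U E : {set Q}) (x y : Q) (w u v : word X).

Fixpoint stays W x w : bool :=
  if w is l :: w' then (x \in W) && stays W (x * letter_value f l) w'
  else x \in W.

Lemma stays_start W x w : stays W x w -> x \in W.
Proof. by case: w => [|l w] //= /andP[]. Qed.

Lemma stays_end W x w : stays W x w -> x * ev f w \in W.
Proof.
elim: w x => [|l w IHw] x; rewrite ?mulg1 //=.
by move=> /andP[_ /IHw]; rewrite mulgA.
Qed.

Lemma stays_cat W x u v :
  stays W x (u ++ v) = stays W x u && stays W (x * ev f u) v.
Proof.
elim: u x => [|l u IHu] x /=; last by rewrite IHu mulgA andbA.
by rewrite mulg1; apply/idP/andP => [xv|[]] //; split=> //; apply: stays_start xv.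
Qed.

Lemma stays_inv W x w : stays W x w -> stays W (x * ev f w) (inv_word w).
Proof.
elim: w x => [|l w IHw] x; first by rewrite /= mulg1.
move=> /= /andP[xW sw]; rewrite mulgA inv_word_cons stays_cat IHw //=.
by rewrite letter_valueN ev_inv !mulgK xW (stays_start sw).
Qed.

Lemma stays_sub W W' x w : W \subset W' -> stays W x w -> stays W' x w.
Proof.
move=> /fintype.subsetP WW'; elim: w x => [|l w IHw] x /=; first exact: WW'.
by move=> /andP[/WW' -> /IHw].
Qed.

(** Connectedness in terms of cuts rather than paths, since this is the form that
    the minimality of a Cheeger set gives. *)
Definition cut_connected W : Prop :=
  forall E, E \subset W -> E != finset.set0 ->
    (forall x s, x \in W -> x * f s \in W -> (x \in E) = (x * f s \in E)) -> E = W.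

Lemma cut_connected_walk W x y :
  cut_connected W -> x \in W -> y \in W ->
  exists w, stays W x w /\ x * ev f w = y.
Proof.
move=> cW xW yW.
pose E := [set z | `[< exists w, stays W x w /\ x * ev f w = z >]]%SET.
suff EW : E = W.
  by have : y \in E; [rewrite EW|rewrite inE => /asboolP].
apply: cW.
- apply/fintype.subsetP => z; rewrite inE => /asboolP[w [xw <-]]; exact: stays_end.
- apply/set0Pn; exists x; rewrite inE; apply/asboolP.
  by exists [::]; rewrite /= mulg1.
- move=> z s zW zsW; rewrite !inE; apply/asboolP/asboolP => -[w [xw xwz]].
  + exists (w ++ [:: (s, true)]); rewrite stays_cat xw xwz /= zW /letter_value /=.
    by rewrite zsW ev_cat mulgA xwz /= /letter_value /= mulg1.
  + exists (w ++ [:: (s, false)]); rewrite stays_cat xw xwz /= zsW /letter_value /=.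
    by rewrite ev_cat mulgA xwz /= /letter_value /= mulg1 mulgK.
Qed.

End Walks.

Section Loops.
Variables (X : finType) (G : groupType) (Q : finGroupType).
Variables (e : X -> G) (q : {multiplicative G -> Q}).
Local Notation f := (q \o e).
Implicit Types (W : {set Q}).

(** This is the image in [G] of the fundamental group, based at [1], of the
    subgraph of the Cayley graph of [Q] induced on [W]. *)
Definition loops W : set G :=
  [set g | exists w, [/\ stays f W 1 w, ev f w = 1 & ev e w = g]].

Lemma loops_kernel W g : loops W g -> q g = 1.
Proof. by move=> [w [_ w1 <-]]; rewrite ev_hom. Qed.

Lemma loops_subgroup W : 1 \in W -> is_subgroup (loops W).
Proof.
move=> W1; split.
- by exists [::].
- move=> _ _ [u [su u1 <-]] [v [sv v1 <-]]; exists (u ++ v).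
  by rewrite stays_cat su u1 mulg1 sv !ev_cat u1 v1 mulg1.
- move=> _ [u [su u1 <-]]; exists (inv_word u); rewrite !ev_inv u1 invg1.
  by have := stays_inv su; rewrite u1 mulg1.
Qed.

Lemma loops_conj W (u v w : word X) :
  stays f W 1 u -> stays f W (ev f u) w -> stays f W 1 v ->
  ev f v = ev f u * ev f w ->
  loops W (ev e u * ev e w * (ev e v)^-1).
Proof.
move=> su sw sv uvw; exists ((u ++ w) ++ inv_word v).
rewrite !stays_cat su mul1g sw mul1g ev_cat -uvw !ev_cat -uvw !ev_inv mulgV.
by have := stays_inv sv; rewrite mul1g => ->.
Qed.

(** A tree on [U] inside [W], given by its paths [tau] from the root and its edges
    [E]. That [tau] runs along an edge of [E] is only asked for in [G], where the
    generator of [loops W] belonging to that edge becomes trivial. *)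
Record spanning_tree W (U : {set Q}) (tau : Q -> word X) (E : {set Q * X}) : Prop :=
  SpanningTree {
    tree_root : tau 1 = [::];
    tree_sub : U \subset W;
    tree_path : forall x, x \in U -> stays f W 1 (tau x) /\ ev f (tau x) = x;
    tree_edge : forall i, i \in E -> [/\ i.1 \in U, i.1 * f i.2 \in U
        & ev e (tau i.1) * e i.2 = ev e (tau (i.1 * f i.2))];
    tree_card : #|E|.+1 = #|U| }.

Lemma spanning_treeP W :
  cut_connected f W -> 1 \in W ->
  exists tau E, spanning_tree W W tau E.
Proof.
move=> cW W1.
suff tree n : (0 < n <= #|W|)%N ->
    exists U tau E, spanning_tree W U tau E /\ (1 \in U /\ #|U| = n).
  have [|U [tau [E [tE [_ Un]]]]] := tree #|W|.
    by rewrite leqnn andbT; apply/card_gt0P; exists 1.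
  have UW : U = W by apply/eqP; rewrite eqEcard (tree_sub tE) Un leqnn.
  by rewrite UW in tE; exists tau, E.
case: n => // n; elim: n => [|n IHn] nW.
  exists [set 1]%SET, (fun=> [::]), finset.set0; split; last by rewrite set11 cards1.
  split=> //.
  - by rewrite finset.sub1set.
  - by move=> x /set1P ->; rewrite /= W1.
  - by move=> i; rewrite inE.
  - by rewrite cards0 cards1.
have [|U [tau [E [[t1 UW tU tE cE] [U1 Un]]]]] := IHn; first by rewrite (ltnW nW).
have [x [s [xW xsW xsU]]] : exists x s,
    [/\ x \in W, x * f s \in W & (x \in U) != (x * f s \in U)].
  apply: contrapT => noedge; have UW' : U = W.
    apply: cW => // [|x s xW xsW]; first by apply/set0Pn; exists 1.
    by apply/eqP; apply: contrapT => /negP xsU; apply: noedge; exists x, s.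
  by move: nW; rewrite -UW' Un /= ltnn.
(* The new edge joins z in the tree to the new vertex y. *)
pose y := if x \in U then x * f s else x.
pose z := if x \in U then x else x * f s.
pose l := (s, x \in U).
have yU : y \notin U.
  by move: xsU; rewrite /y; case: (boolP (x \in U)) => //=; case: (_ \in U).
have zU : z \in U.
  by move: xsU; rewrite /z; case: (boolP (x \in U)) => //= _; case: (_ \in U).
have yW : y \in W by rewrite /y; case: ifP.
have zl : z * letter_value f l = y.
  by rewrite /z /l /letter_value /y; case: ifP => //= _; rewrite mulgK.
pose tau' t := if t == y then tau z ++ [:: l] else tau t.
have tauU t : t \in U -> tau' t = tau t.
  by move=> tU'; rewrite /tau' ifN //; apply: contraNneq yU => <-.
have tauy : tau' y = tau z ++ [:: l] by rewrite /tau' eqxx.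
exists (y |: U)%SET, tau', ((x, s) |: E)%SET; split; last first.
  by rewrite cardsU1 yU Un setU1r.
have [sz ez] := tU z zU.
have xsE : (x, s) \notin E.
  by apply/negP => /tE [/= xU xsU' _]; move: xsU; rewrite xU xsU'.
split.
- by rewrite tauU.
- by rewrite finset.subUset finset.sub1set yW.
- move=> t /setU1P [->|tU']; last by rewrite tauU //; exact: tU.
  by rewrite tauy stays_cat sz ev_cat ez mul1g /= mulg1 zl yW (fintype.subsetP UW z zU).
- move=> i /setU1P [->|/tE [i1 i2 iE]]; last by rewrite !tauU // !setU1r.
  rewrite /=; have tz : tau' z = tau z by exact: tauU.
  have [xU|xU] := boolP (x \in U).
    have yE : x * q (e s) = y by rewrite /y xU.
    have zE : x = z by rewrite /z xU.
    rewrite yE; split; [exact: setU1r|exact: setU11|].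
    by rewrite tauy {1}zE tz ev_cat /= mulg1 /l xU.
  have zE : x * q (e s) = z by rewrite /z /= (negPf xU).
  have yE : x = y by rewrite /y (negPf xU).
  rewrite zE; split; [by rewrite {1}yE setU11|exact: setU1r|].
  by rewrite {1}yE tauy tz ev_cat /= /l (negPf xU) /letter_value /= mulg1 mulgVK.
- by rewrite !cardsU1 xsE yU -cE.
Qed.

(** Each of the at most [#|X| * #|W|] edges of the subgraph gives a generator, and
    the [#|W| - 1] edges of a spanning tree give trivial ones. *)
Lemma loops_rank W :
  cut_connected f W -> 1 \in W ->
  exists S : {fset G}, generated [set` S] = loops W /\
    (#|` S| + #|W| <= #|X| * #|W| + 1)%N.
Proof.
move=> cW W1; have [tau [E [t1 _ tW tE cE]]] := spanning_treeP cW W1.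
pose gam (i : Q * X) := ev e (tau i.1) * e i.2 * (ev e (tau (i.1 * f i.2)))^-1.
pose D := [set i : Q * X | (i.1 \in W) && (i.1 * f i.2 \in W)]%SET.
pose S := [fset gam i | i in D :\: E]%fset; exists S.
have ED : E \subset D by apply/fintype.subsetP => i /tE [? ? _]; rewrite inE; apply/andP.
split; last first.
  have DW : (#|D| <= #|X| * #|W|)%N.
    rewrite mulnC -[#|X|]cardsT -cardsX; apply: subset_leq_card.
    by apply/fintype.subsetP => i; rewrite !inE => /andP[-> _].
  have SD : (#|` S| <= #|D :\: E|)%N.
    by rewrite (leq_trans (leq_imfset_card _ _ _)) // cardE.
  rewrite -{1}cE addnS addn1 ltnS; apply: leq_trans DW.
  by rewrite -(cardsID E D) (finset.setIidPr ED) addnC leq_add2l.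
have Dgam i : i \in D -> loops W (gam i).
  rewrite inE => /andP[iW iW']; have [[s1 v1] [s2 v2]] := (tW _ iW, tW _ iW').
  have -> : gam i =
      ev e (tau i.1) * ev e [:: (i.2, true)] * (ev e (tau (i.1 * f i.2)))^-1.
    by rewrite /= mulg1.
  apply: loops_conj => //=; first by rewrite v1 iW.
  by rewrite v1 v2 /letter_value /= mulg1.
have sS := generated_subgroup [set` S]; case: (sS) => S1 SM SV.
have Sgam i : i \in D -> generated [set` S] (gam i).
  move=> iD; case iE : (i \in E).
    by have [_ _ gi] := tE i iE; rewrite /gam gi mulgV.
  by apply: sub_generated => /=; apply/imfsetP; exists i => //=; rewrite inE iE.
apply/seteqP; split=> g /=.
- move=> Sg; apply: (Sg (loops W)); first exact: loops_subgroup.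
  by move=> _ /= /imfsetP [i /= /finset.setDP[iD _] ->]; exact: Dgam.
- move=> [w [sw w1 <-]].
  suff Sw x : stays f W x w -> generated [set` S]
      (ev e (tau x) * ev e w * (ev e (tau (x * ev f w)))^-1).
    by have := Sw 1 sw; rewrite w1 mulg1 t1 /= invg1 mulg1 mul1g.
  elim: w x {sw w1} => [|[s b] w IHw] x.
    by rewrite /= !mulg1 mulgV.
  move=> /= /andP[xW sw]; set y := x * letter_value f (s, b) in sw *.
  have yW := stays_start sw.
  suff Sl : generated [set` S] (ev e (tau x) * letter_value e (s, b) * (ev e (tau y))^-1).
    by have := SM _ _ Sl (IHw y sw); rewrite !mulgA mulgVK.
  rewrite /y; case: (b) @y sw yW => y sw yW; rewrite /letter_value /=.
    by have := Sgam (x, s); rewrite inE /= xW; exact.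
  have := SV _ (Sgam (y, s) _); rewrite /gam /= !invgM invgK mulgA mulgVK; apply.
  by rewrite inE /= yW mulgVK.
Qed.

End Loops.

(** * Splitting a kernel along a connected cut *)

Section Thickening.
Variables (X : finType) (Q : finGroupType) (f : X -> Q).
Implicit Types (A : {set Q}) (x : Q) (w : word X).

Definition thicken n A : {set Q} :=
  [set x | `[< exists u, (size u <= n)%N /\ x * ev f u \in A >]]%SET.

Lemma thickenP n A x :
  reflect (exists u, (size u <= n)%N /\ x * ev f u \in A) (x \in thicken n A).
Proof. by rewrite inE; exact: asboolP. Qed.

Lemma sub_thicken n A : A \subset thicken n A.
Proof.
by apply/fintype.subsetP => x xA; apply/thickenP; exists [::]; rewrite mulg1.
Qed.

Lemma thicken_edge n A x s : (0 < n)%N ->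
  (x \in thicken n A) && (x * f s \in thicken n A) ||
  (x \in ~: A)%SET && (x * f s \in ~: A)%SET.
Proof.
move=> n0; rewrite !finset.in_setC.
have thA y : y \in A -> y \in thicken n A by apply/fintype.subsetP/sub_thicken.
have [xA|xA] := boolP (x \in A).
  rewrite (thA x) //=; apply/orP; left; apply/thickenP.
  by exists [:: (s, false)]; rewrite /= mulg1 /letter_value /= mulgK.
have [xsA|_] := boolP (x * f s \in A); last by rewrite orbT.
rewrite (thA (x * f s)) // andbT; apply/orP; left; apply/thickenP.
by exists [:: (s, true)]; rewrite /= mulg1.
Qed.

Lemma stays_exit A x w :
  ~~ stays f (~: A)%SET x w -> exists u v, w = u ++ v /\ x * ev f u \in A.
Proof.
elim: w x => [|l w IHw] x /=.
  by rewrite finset.in_setC negbK => xA; exists [::], [::]; rewrite mulg1.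
rewrite negb_and finset.in_setC negbK => /orP[xA|/IHw [u [v [-> uA]]]].
  by exists [::], (l :: w); rewrite mulg1.
by exists (l :: u), v; rewrite /= mulgA.
Qed.

Lemma stays_prefix (W : {set Q}) x w :
  (forall u v, w = u ++ v -> x * ev f u \in W) -> stays f W x w.
Proof.
elim: w x => [|l w IHw] x H /=; first by rewrite -[x]mulg1 (H [::] [::]).
rewrite -{1}[x]mulg1 (H [::] (l :: w)) //=; apply: IHw => u v wuv.
by rewrite -mulgA -[X in x * X]/(ev f (l :: u)) (H _ v) // wuv.
Qed.

(** A walk of length at most [n] that meets [A] stays within distance [n] of it. *)
Lemma short_walk n A x w : (size w <= n)%N ->
  stays f (~: A)%SET x w || stays f (thicken n A) x w.
Proof.
move=> wn; have [//|/stays_exit [u [v [wuv uA]]]] := boolP (stays f _ x w).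
apply: stays_prefix => u' v' wuv'; apply/thickenP.
have [uu'|/ltnW uu'] := leqP (size u) (size u').
- have u'E : u' = u ++ drop (size u) u'.
    have := congr1 (take (size u)) (etrans (esym wuv) wuv').
    rewrite take_size_cat // takel_cat // => {1}->.
    by rewrite cat_take_drop.
  exists (inv_word (drop (size u) u')).
  rewrite size_inv_word {2}u'E ev_cat ev_inv mulgA mulgK; split=> //.
  rewrite size_drop (leq_trans (leq_subr _ _)) // (leq_trans _ wn) // wuv'.
  by rewrite size_cat leq_addr.
- have uE : u = u' ++ drop (size u') u.
    have := congr1 (take (size u')) (etrans (esym wuv') wuv).
    rewrite take_size_cat // takel_cat // => {1}->.
    by rewrite cat_take_drop.
  exists (drop (size u') u); rewrite -mulgA -ev_cat -uE; split=> //.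
  rewrite size_drop (leq_trans (leq_subr _ _)) // (leq_trans _ wn) // wuv.
  by rewrite size_cat leq_addr.
Qed.

Lemma stays_cut (W E : {set Q}) x w :
  (forall y s, y \in W -> y * f s \in W -> (y \in E) = (y * f s \in E)) ->
  stays f W x w -> (x \in E) = (x * ev f w \in E).
Proof.
move=> cE; elim: w x => [|[s b] w IHw] x /=; first by rewrite mulg1.
move=> /andP[xW sw]; rewrite mulgA -IHw //; have := stays_start sw.
rewrite /letter_value; case: b {sw} => /= yW; first exact: cE.
by rewrite [RHS](cE _ s yW) mulgVK.
Qed.

Lemma thicken_connected n A : cut_connected f A -> cut_connected f (thicken n A).
Proof.
move=> cA E EA' /set0Pn [x0 x0E] cE.
have AA' := fintype.subsetP (sub_thicken n A).
have to_A y : y \in thicken n A -> exists2 a, a \in A & (y \in E) = (a \in E).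
  move=> /thickenP [u [un uA]]; exists (y * ev f u) => //.
  apply: (stays_cut cE); have := short_walk A y un.
  case: (boolP (stays _ (~: A)%SET _ _)) => //.
  by move=> /stays_end; rewrite finset.in_setC uA.
have EA : A :&: E = A.
  apply: cA; first exact: subsetIl.
  - have [a aA] := to_A x0 (fintype.subsetP EA' _ x0E).
    by rewrite x0E => /esym aE; apply/set0Pn; exists a; rewrite inE aA.
  - by move=> x s xA xsA; rewrite !inE xA xsA; apply: cE; exact: AA'.
apply/eqP; rewrite finset.eqEsubset EA'; apply/fintype.subsetP => y /to_A [a aA ->].
by move: aA; rewrite -{1}EA inE => /andP[].
Qed.

End Thickening.

Section Splitting.
Variables (X : finType) (G : groupType) (Q : finGroupType) (e : X -> G).
Variables (q : {multiplicative G -> Q}) (n : nat).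
Local Notation f := (q \o e).
Hypothesis n_gt0 : (0 < n)%N.
Hypothesis e_gen : forall g, exists w, ev e w = g.
Hypothesis e_presents : forall w, ev e w = 1 -> word_eq (short_relators e n) w [::].
Variable A : {set Q}.
Local Notation A' := (thicken f n A).
Local Notation B := (~: A)%SET.
Local Notation C := (A' :&: B)%SET.
Hypotheses (cA : cut_connected f A) (cB : cut_connected f B) (C1 : 1 \in C).
Local Notation N := [set g | q g = 1].

Lemma base_A' : 1 \in A'. Proof. by move: C1; rewrite finset.in_setI => /andP[]. Qed.
Lemma base_B : 1 \in B. Proof. by move: C1; rewrite finset.in_setI => /andP[]. Qed.

Lemma sub_CA' : C \subset A'. Proof. exact: subsetIl. Qed.
Lemma sub_CB : C \subset B. Proof. exact: subsetIr. Qed.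

(** Every edge and every relator lies in one of the two pieces, so a cocycle only
    has to be checked on each piece. *)
Lemma cocycle_well_defined (K : groupType) (c : Q -> X -> K) :
  (forall W x w, W = A' \/ W = B -> stays f W x w -> ev e w = 1 ->
     cocycle f c x w = 1) ->
  forall u v, ev e u = ev e v -> forall x, cocycle f c x u = cocycle f c x v.
Proof.
move=> c1 u v uv; apply: (@cocycle_word_eq _ _ _ _ _ (short_relators e n)).
- by move=> r [_ r1]; rewrite -ev_hom r1 hom1.
- move=> r x [rn r1]; have /orP[s|s] := short_walk f A x rn.
  + by apply: (c1 B) => //; right.
  + by apply: (c1 A') => //; left.
- apply/class_ofP; apply/divg1_eq; rewrite -class_of_inv -class_ofM.
  by apply/class_ofP/e_presents; rewrite ev_cat ev_inv uv mulgV.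
Qed.

(** Mayer-Vietoris. Let [E] be a union of components of [C]. The coboundary of the
    indicator of [E], taken on the edges of [A'] only, is a cocycle: on the edges
    that also lie in [B] it vanishes. A loop that goes from [E] to the rest of [C]
    inside [B] and returns inside [A'] has value 1. *)
Lemma disconnected_cut_hnn : ~ cut_connected f C -> is_hnn N.
Proof.
move=> dC.
have [E [EC E1 E2 cE]] : exists E : {set Q}, [/\ E \subset C, 1 \in E, E != C &
    forall x s, x \in C -> x * f s \in C -> (x \in E) = (x * f s \in E)].
  apply: contrapT => noE; apply: dC => E EC E0 cE; apply: contrapT => /eqP EneC.
  have [E1|E1] := boolP (1 \in E); first by apply: noE; exists E.
  apply: noE; exists (C :\: E); split.
  - exact: subsetDl.
  - by rewrite finset.in_setD E1.
  - case/set0Pn: E0 => x xE; apply/eqP => CE.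
    by have := fintype.subsetP EC x xE; rewrite -CE finset.in_setD xE.
  - by move=> x s xC xsC; rewrite !finset.in_setD xC xsC (cE x s).
have [y yC yE] : exists2 y, y \in C & y \notin E.
  have : ~~ (C \subset E) by apply: contra E2 => CE; rewrite finset.eqEsubset EC.
  by case/subsetPn => y; exists y.
pose F (x : Q) : int := Posz (x \in E).
pose c x s : zgroup :=
  if (x \in A') && (x * f s \in A') then (F (x * f s)%g - F x)%R else (0%R : int).
have zM (a b : zgroup) : a * b = ((a : int) + (b : int))%R by [].
have zV (a : zgroup) : a^-1 = (- (a : int))%R by [].
have cA' x w : stays f A' x w -> cocycle f c x w = (F (x * ev f w)%g - F x)%R.
  elim: w x => [|[s b] w IHw] x; first by rewrite /= mulg1 subrr.
  move=> /= /andP[xA sw]; have yA := stays_start sw; rewrite IHw // zM mulgA.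
  have -> : cocycle_letter f c x (s, b) = (F (x * letter_value f (s, b))%g - F x)%R.
    move: yA; rewrite /cocycle_letter /letter_value; case: b {sw} => /= yA.
      by rewrite /c xA yA.
    by rewrite zV /c yA mulgVK xA opprB.
  by rewrite addrC addrA subrK.
have cB' x w : stays f B x w -> cocycle f c x w = (0%R : int).
  have cBs z s : z \in B -> z * f s \in B -> c z s = (0%R : int).
    move=> zB zsB; rewrite /c; case: ifP => // /andP[zA zsA].
    by rewrite /F -cE ?subrr // finset.in_setI ?zA ?zsA.
  elim: w x => [|[s b] w IHw] x //= /andP[xB sw]; have yB := stays_start sw.
  rewrite IHw // zM addr0; move: yB; rewrite /cocycle_letter /letter_value.
  case: b {sw} => /= yB; first by rewrite cBs.
  by rewrite zV cBs ?mulgVK // oppr0.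
have wd u v : ev e u = ev e v -> forall x, cocycle f c x u = cocycle f c x v.
  apply: cocycle_well_defined => W x w [->|->] sw w1; last exact: cB'.
  by rewrite cA' // -ev_hom w1 hom1 mulg1 subrr.
have [lift liftE] := choice e_gen.
pose chi g : int := cocycle f c 1 (lift g).
have chiE w : chi (ev e w) = cocycle f c 1 w by apply: wd; rewrite liftE.
have [yA yB] : y \in A' /\ y \in B by move: yC; rewrite finset.in_setI => /andP[].
have [u [su uy]] := cut_connected_walk cB base_B yB.
have [v [sv vy]] := cut_connected_walk (thicken_connected (n := n) cA) yA base_A'.
apply: (@hnn_of_map_onto_Z _ _ chi (ev e (u ++ v))).
- exact: kernel_subgroup.
- move=> g h /= qg qh; rewrite -(liftE g) -(liftE h) -ev_cat !chiE cocycle_cat.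
  by rewrite -(ev_hom e q) liftE qg mulg1.
- by rewrite /= ev_hom ev_cat -[RHS]vy -uy mul1g.
- rewrite chiE cocycle_cat uy cB' // cA' // vy zM /F E1 (negPf yE).
  by rewrite subr0 add0r.
Qed.

(** Van Kampen. The three vertex and edge groups are taken to be the images in [G]
    of the fundamental groups: the pushout of the fundamental groups, which is the
    kernel, maps onto the amalgam of their images, and that maps back to the kernel.
    So the edge group embeds without any normal form theorem. The inverse map comes from the cocycle that labels an edge by
    the loop obtained by joining its ends to the base point along [tau]. *)
Lemma connected_cut_amalgam : cut_connected f C ->
  [\/ is_nontrivial_amalgam N, N = loops e q A' | N = loops e q B].
Proof.
move=> cC.
have cA' : cut_connected f A' by exact: thicken_connected.
have [tau [tau1 tauE tauA tauB tauC]] : exists tau : Q -> word X,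
    [/\ tau 1 = [::], forall x, (x \in A') || (x \in B) -> ev f (tau x) = x,
      forall x, x \in A' -> stays f A' 1 (tau x),
      forall x, x \in B -> stays f B 1 (tau x) &
      forall x, x \in C -> stays f C 1 (tau x)].
  have walk x : exists w, [/\ (x \in A') || (x \in B) -> ev f w = x,
      x \in A' -> stays f A' 1 w, x \in B -> stays f B 1 w & x \in C -> stays f C 1 w].
    have [xA|xA] := boolP (x \in A'); have [xB|xB] := boolP (x \in B).
    - have xC : x \in C by rewrite finset.in_setI xA.
      have [w [sw wx]] := cut_connected_walk cC C1 xC.
      exists w; rewrite -[X in _ = X]wx mul1g; split=> // _.
      + exact: stays_sub sub_CA' sw.
      + exact: stays_sub sub_CB sw.
    - have [w [sw wx]] := cut_connected_walk cA' base_A' xA.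
      exists w; rewrite -[X in _ = X]wx mul1g; split=> //.
      by rewrite finset.in_setI (negPf xB) andbF.
    - have [w [sw wx]] := cut_connected_walk cB base_B xB.
      exists w; rewrite -[X in _ = X]wx mul1g; split=> //.
      by rewrite finset.in_setI (negPf xA).
    - by exists [::]; rewrite /= finset.in_setI (negPf xA).
  have [t tE] := choice walk.
  exists (fun x => if x == 1 then [::] else t x); split.
  - by rewrite eqxx.
  - by move=> x xAB; case: eqP => [-> //|_]; case: (tE x) => ->.
  - by move=> x xA; case: eqP => [_|_]; [exact: base_A'|case: (tE x) => _ ->].
  - by move=> x xB; case: eqP => [_|_]; [exact: base_B|case: (tE x) => _ _ ->].
  - by move=> x xC; case: eqP => [_|_]; [exact: C1|case: (tE x) => _ _ _ ->].
have inAB x : (x \in A') || (x \in B).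
  rewrite finset.in_setC orbC; case: (boolP (x \in A)) => //= xA.
  exact: (fintype.subsetP (sub_thicken f n A)).
have {}tauE x : ev f (tau x) = x by exact: tauE.
pose g x w := ev e (tau x) * ev e w * (ev e (tau (x * ev f w)))^-1.
(* The walk w closed up to a loop at the base point. *)
have g_cat x u v : g x (u ++ v) = g x u * g (x * ev f u) v.
  by rewrite /g !ev_cat !mulgA mulgVK.
have g_loop x w : ev e w = 1 -> g x w = 1.
  by move=> w1; rewrite /g -(ev_hom e q) w1 hom1 !mulg1 mulgV.
have g_base w : ev f w = 1 -> g 1 w = ev e w.
  by move=> w1; rewrite /g w1 mulg1 tau1 /= mul1g invg1 mulg1.
have gW (W : {set Q}) x w : (forall y, y \in W -> stays f W 1 (tau y)) -> stays f W x w ->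
    loops e q W (g x w).
  move=> tW sw; have [xW yW] := (stays_start sw, stays_end sw).
  by apply: loops_conj; rewrite ?tauE //; exact: tW.
have letter_in x l : stays f A' x [:: l] || stays f B x [:: l].
  case: l => s b; rewrite /= /letter_value; case: b => /=.
    exact: thicken_edge.
  by rewrite andbC [X in _ || X]andbC -{2 4}[x](mulgVK (q (e s))); exact: thicken_edge.
have sP := loops_subgroup e q base_A'; have sQ := loops_subgroup e q base_B.
have sR := loops_subgroup e q C1.
have RP h : loops e q C h -> loops e q A' h.
  by move=> [w [sw w1 wh]]; exists w; split=> //; exact: stays_sub sub_CA' sw.
have RQ h : loops e q C h -> loops e q B h.
  by move=> [w [sw w1 wh]]; exists w; split=> //; exact: stays_sub sub_CB sw.
have g_in (K : set G) : is_subgroup K -> loops e q A' `<=` K -> loops e q B `<=` K ->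
    N `<=` K.
  move=> [K1 KM KV] PK QK h /= h1; have [w wh] := e_gen h.
  have w1 : ev f w = 1 by rewrite -(ev_hom e q) wh.
  rewrite -wh -g_base //; elim: w {wh w1} 1 => [|l w IHw] x.
    by rewrite g_loop.
  rewrite -cat1s g_cat; apply: (KM) => //.
  by case/orP: (letter_in x l) => sl; [apply: PK|apply: QK]; apply: gW.
(* If the edge group is a whole vertex group, the other one is the kernel. *)
have [RP'|PR] := pselect (loops e q A' `<=` loops e q C).
  apply: Or33; apply/seteqP; split=> [|h]; last exact: loops_kernel.
  by apply: g_in => // h /RP' /RQ.
have [RQ'|QR] := pselect (loops e q B `<=` loops e q C).
  apply: Or32; apply/seteqP; split=> [|h]; last exact: loops_kernel.
  by apply: g_in => // h /RQ' /RP.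
apply: Or31.
pose P : groupType := subgroup_type sP; pose Q' : groupType := subgroup_type sQ.
pose R : groupType := subgroup_type sR.
pose toP (h : G) : P := insubd 1 h; pose toQ (h : G) : Q' := insubd 1 h.
have toPK h : loops e q A' h -> val (toP h) = h.
  by move=> Ph; rewrite insubdK //; exact/asboolP.
have toQK h : loops e q B h -> val (toQ h) = h.
  by move=> Qh; rewrite insubdK //; exact/asboolP.
have valP_in (p : P) : loops e q A' (val p) by exact/asboolP/(valP p).
have valQ_in (p : Q') : loops e q B (val p) by exact/asboolP/(valP p).
have valR_in (p : R) : loops e q C (val p) by exact/asboolP/(valP p).
have [i iE] : exists i : {multiplicative R -> P}, forall r, val (i r) = val r.
  have [|i iE] := @exists_hom R P (fun r => toP (val r)).
    move=> r r'; apply: val_inj.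
    by rewrite [RHS]valM !toPK; [exact: valM|exact: RP (valR_in _)..].
  by exists i => r; rewrite iE toPK //; exact: RP.
have [j jE] : exists j : {multiplicative R -> Q'}, forall r, val (j r) = val r.
  have [|j jE] := @exists_hom R Q' (fun r => toQ (val r)).
    move=> r r'; apply: val_inj.
    by rewrite [RHS]valM !toQK; [exact: valM|exact: RQ (valR_in _)..].
  by exists j => r; rewrite jE toQK //; exact: RQ.
exists P, Q', R, i, j; split.
- by move=> r r' /(congr1 val); rewrite !iE; exact: val_inj.
- by move=> r r' /(congr1 val); rewrite !jE; exact: val_inj.
- move=> iT; apply: PR => h Ph; have : range i (toP h) by rewrite iT.
  by move=> [r _ /(congr1 val)]; rewrite iE toPK // => <-.
- move=> jT; apply: QR => h Qh; have : range j (toQ h) by rewrite jT.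
  by move=> [r _ /(congr1 val)]; rewrite jE toQK // => <-.
pose K : groupType := amalgam i j.
pose inP (h : G) : K := class_of (amalgam_rel i j) [:: (inl (toP h), true)].
pose inQ (h : G) : K := class_of (amalgam_rel i j) [:: (inr (toQ h), true)].
have inPM h k : loops e q A' h -> loops e q A' k -> inP (h * k) = inP h * inP k.
  move=> Ph Pk; have /class_ofP := word_eq_rel (amalgam_rell i j (toP h) (toP k)).
  rewrite !class_of_ev => hk.
  have {hk} : inP h * (inP k * ((class_of _ [:: (inl (toP h * toP k), true)])^-1 * 1)) = 1.
    exact: hk.
  have -> : toP h * toP k = toP (h * k).
    apply: val_inj; rewrite valM !toPK //; by case: (sP) => _ PM _; exact: PM.
  by rewrite mulg1 mulgA => /divg1_eq.
have inQM h k : loops e q B h -> loops e q B k -> inQ (h * k) = inQ h * inQ k.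
  move=> Ph Pk; have /class_ofP := word_eq_rel (amalgam_relr i j (toQ h) (toQ k)).
  rewrite !class_of_ev => hk.
  have {hk} : inQ h * (inQ k * ((class_of _ [:: (inr (toQ h * toQ k), true)])^-1 * 1)) = 1.
    exact: hk.
  have -> : toQ h * toQ k = toQ (h * k).
    apply: val_inj; rewrite valM !toQK //; by case: (sQ) => _ PM _; exact: PM.
  by rewrite mulg1 mulgA => /divg1_eq.
have inPQ h : loops e q C h -> inP h = inQ h.
  move=> Rh; pose r : R := insubd 1 h.
  have rh : val r = h by rewrite insubdK //; exact/asboolP.
  have /class_ofP := word_eq_rel (amalgam_relR i j r); rewrite !class_of_ev.
  have -> : i r = toP h by apply: val_inj; rewrite iE toPK //; exact: RP.
  have -> : j r = toQ h by apply: val_inj; rewrite jE toQK //; exact: RQ.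
  move=> hh; have {hh} : inP h * ((inQ h)^-1 * 1) = 1 by exact: hh.
  by rewrite mulg1 => /divg1_eq.
pose c x s : K :=
  if (x \in A') && (x * f s \in A') then inP (g x [:: (s, true)])
  else inQ (g x [:: (s, true)]).
have cocycleW (W : {set Q}) (inW : G -> K) :
    (forall h k, loops e q W h -> loops e q W k -> inW (h * k) = inW h * inW k) ->
    (forall x, x \in W -> stays f W 1 (tau x)) ->
    (forall x s, x \in W -> x * f s \in W -> c x s = inW (g x [:: (s, true)])) ->
    forall x w, stays f W x w -> cocycle f c x w = inW (g x w).
  move=> inWM tW cW x w sw.
  have W1 : 1 \in W by apply: stays_start (tW x (stays_start sw)).
  have inW1 : inW 1 = 1.
    apply: (mulgI (inW 1)); rewrite -inWM ?mulg1 //; by case: (loops_subgroup e q W1).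
  elim: w x sw => [|[s b] w IHw] x sw; first by rewrite g_loop.
  rewrite -cat1s g_cat inWM; first last.
  - by apply: gW => //; move: sw; rewrite -cat1s stays_cat => /andP[].
  - by apply: gW => //; move: sw; rewrite -cat1s stays_cat => /andP[].
  move: sw => /= /andP[xW sw]; rewrite IHw // mulg1; congr (_ * _).
  have yW := stays_start sw.
  case: b sw yW => /= sw; rewrite /cocycle_letter /letter_value /= => yW.
    exact: cW.
  rewrite cW ?mulgVK //; apply: mulg1_eq; rewrite -inWM.
  - have xE : x = x * (f s)^-1 * ev f [:: (s, true)].
      by rewrite /= /letter_value /= mulg1 mulgVK.
    rewrite [X in _ * g X _]xE -g_cat g_loop //.
    by rewrite /= /letter_value /= mulg1 mulgV.
  - by apply: gW => //=; rewrite yW /letter_value /= mulgVK.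
  - by apply: gW => //=; rewrite xW /letter_value /=.
have cP x w : stays f A' x w -> cocycle f c x w = inP (g x w).
  by apply: cocycleW => // y s yA ysA; rewrite /c yA ysA.
have cQ x w : stays f B x w -> cocycle f c x w = inQ (g x w).
  apply: cocycleW => // y s yB ysB; rewrite /c; case: ifP => // /andP[yA ysA].
  apply: inPQ; apply: gW => //=.
  by rewrite /letter_value /=; apply/andP; split; rewrite finset.in_setI ?yA ?ysA.
have inP1 : inP 1 = 1.
  by apply: (mulgI (inP 1)); rewrite -inPM ?mulg1 //; case: (sP).
have inQ1 : inQ 1 = 1.
  by apply: (mulgI (inQ 1)); rewrite -inQM ?mulg1 //; case: (sQ).
have wd u v : ev e u = ev e v -> forall x, cocycle f c x u = cocycle f c x v.
  apply: cocycle_well_defined => W x w [->|->] sw w1.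
  - by rewrite cP // g_loop.
  - by rewrite cQ // g_loop.
pose b (x : P + Q') : G := match x with inl p => val p | inr p => val p end.
have [|h hE] := @presented_hom _ (amalgam_rel i j) G b.
  move=> _ [p p'|p p'|r].
  - change (val p * (val p' * ((val (p * p'))^-1 * 1)) = 1).
    by rewrite mulg1 valM mulgA mulgV.
  - change (val p * (val p' * ((val (p * p'))^-1 * 1)) = 1).
    by rewrite mulg1 valM mulgA mulgV.
  - change (val (i r) * ((val (j r))^-1 * 1) = 1).
    by rewrite iE jE mulg1 mulgV.
have hP k : loops e q A' k -> h (inP k) = k.
  by move=> Pk; rewrite hE /= mulg1 /letter_value /= toPK.
have hQ k : loops e q B k -> h (inQ k) = k.
  by move=> Pk; rewrite hE /= mulg1 /letter_value /= toQK.
(* Every element of the amalgam is the value of the cocycle along a loop. *)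
have realize a : exists w, [/\ ev f w = 1, ev e w = h a & cocycle f c 1 w = a].
  have [v ->] := class_of_surj a.
  have gen z : exists w, [/\ ev f w = 1, ev e w = h (class_of _ [:: (z, true)])
      & cocycle f c 1 w = class_of _ [:: (z, true)]].
    case: z => p.
    - have [w [sw w1 wp]] := valP_in p.
      have pE : toP (val p) = p by apply: val_inj; rewrite toPK.
      exists w; rewrite cP // g_base // wp; split=> //; last by rewrite /inP pE.
      by rewrite hE /= mulg1.
    - have [w [sw w1 wp]] := valQ_in p.
      have pE : toQ (val p) = p by apply: val_inj; rewrite toQK.
      exists w; rewrite cQ // g_base // wp; split=> //; last by rewrite /inQ pE.
      by rewrite hE /= mulg1.
  elim: v => [|[z d] v [w [w1 wh wc]]].
    by exists [::]; rewrite hE.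
  have [u [u1 uh uc]] : exists u,
      [/\ ev f u = 1, ev e u = h (class_of (amalgam_rel i j) [:: (z, d)])
        & cocycle f c 1 u = class_of (amalgam_rel i j) [:: (z, d)]].
    case: d; first exact: gen.
    have [u [u1 uh uc]] := gen z; exists (inv_word u).
    rewrite -[[:: (z, false)]]/(inv_word [:: (z, true)]) class_of_inv homV.
    rewrite !ev_inv u1 uh -uc invg1.
    split=> //; apply/esym/mulg1_eq.
    have -> : cocycle f c 1 u * cocycle f c 1 (inv_word u) =
        cocycle f c 1 (u ++ inv_word u).
      by rewrite cocycle_cat u1 mulg1.
    by rewrite (wd _ [::]) // ev_cat ev_inv mulgV.
  exists (u ++ w); rewrite -cat1s class_ofM gmulfM !ev_cat u1 w1 uh wh mulg1; split=> //.
  by rewrite cocycle_cat u1 mulg1 uc wc.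
exists h; split.
- apply: hom_inj => a ha; have [w [w1 wh <-]] := realize a.
  by rewrite (wd _ [::]) // wh ha.
- apply/seteqP; split=> [_ [a _ <-]|k /= k1].
    by have [w [w1 <- _]] := realize a; rewrite /= ev_hom.
  have [w wk] := e_gen k; have w1 : ev f w = 1 by rewrite -(ev_hom e q) wk.
  exists (cocycle f c 1 w) => //; rewrite -wk -g_base //.
  elim: w {wk w1} 1 => [|l w IHw] x; first by rewrite hom1 g_loop.
  rewrite -cat1s g_cat cocycle_cat gmulfM IHw; congr (_ * _).
  case/orP: (letter_in x l) => sl.
  - by rewrite cP // hP //; exact: gW.
  - by rewrite cQ // hQ //; exact: gW.
Qed.

End Splitting.

(** * Cheeger-minimal sets of vertices *)

Section Boundary.
Variables (X : finType) (Q : finGroupType) (f : X -> Q).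
Implicit Types (A D E W : {set Q}) (x z g : Q) (w : word X).

Definition crosses A x z : bool := (x \in A) != (x * z \in A).

Definition displacement A z : nat := (\sum_x crosses A x z)%N.

(** The number of boundary edges of [A], counted once for every generator. *)
Definition bd A : nat := (\sum_s displacement A (f s))%N.

Lemma displacement1 A : displacement A 1 = 0%N.
Proof. by rewrite /displacement big1 // => x _; rewrite /crosses mulg1 eqxx. Qed.

Lemma displacementM A z z' :
  (displacement A (z * z') <= displacement A z + displacement A z')%N.
Proof.
have -> : displacement A z' = (\sum_x crosses A (x * z)%g z')%N.
  by rewrite /displacement (reindex_inj (mulIg z)).
rewrite /displacement -big_split /=; apply: leq_sum => x _; rewrite /crosses mulgA.
by case: (x \in A); case: (x * z \in A); case: (_ \in A).
Qed.

Lemma displacementV A z : displacement A z^-1 = displacement A z.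
Proof.
rewrite /displacement (reindex_inj (mulIg z)).
by apply: eq_bigr => x _; rewrite /crosses mulgK eq_sym.
Qed.

Lemma displacement_bd A s : (displacement A (f s) <= bd A)%N.
Proof. by rewrite /bd (bigD1 s) //= leq_addr. Qed.

Lemma displacement_ev A w : (displacement A (ev f w) <= size w * bd A)%N.
Proof.
elim: w => [|[s b] w IHw]; first by rewrite displacement1.
rewrite ev_cons mulSn (leq_trans (displacementM _ _ _)) // leq_add //.
by case: b; rewrite /letter_value /= ?displacementV displacement_bd.
Qed.

Lemma displacementC A z : displacement (~: A)%SET z = displacement A z.
Proof.
apply: eq_bigr => x _; rewrite /crosses !finset.in_setC.
by case: (x \in A); case: (_ \in A).
Qed.

Lemma bdC A : bd (~: A)%SET = bd A.
Proof. by apply: eq_bigr => s _; exact: displacementC. Qed.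

Lemma bd_translate g A : bd (g *: A) = bd A.
Proof.
apply: eq_bigr => s _; rewrite /displacement (reindex_inj (mulgI g)).
by apply: eq_bigr => x _; rewrite /crosses !mem_lcoset mulKg -mulgA mulKg.
Qed.

Lemma bd_pair A : bd A = (\sum_(i : X * Q) crosses A i.2 (f i.1))%N.
Proof. by rewrite /bd /displacement pair_bigA. Qed.

Lemma bd_submodular A D : (bd (A :|: D) + bd (A :&: D) <= bd A + bd D)%N.
Proof.
rewrite !bd_pair -!big_split /=; apply: leq_sum => -[s x] _ /=.
rewrite /crosses !(finset.in_setU, finset.in_setI).
by case: (x \in A); case: (x \in D); case: (_ * _ \in A); case: (_ * _ \in D).
Qed.

Lemma bd_disjoint_edge A D x s :
  (A :&: D = finset.set0)%SET ->
  (x \in A) && (x * f s \in D) || (x \in D) && (x * f s \in A) ->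
  (bd (A :|: D) < bd A + bd D)%N.
Proof.
move=> AD edge; rewrite !bd_pair -!big_split /= (bigD1 (s, x)) //.
rewrite [ltnRHS](bigD1 (s, x)) //=.
have disj y : y \in A -> y \in D -> False.
  by move=> yA yD; have := finset.in_set0 y; rewrite -AD finset.in_setI yA yD.
rewrite /crosses -addSn leq_add //.
  rewrite !finset.in_setU; move: edge (disj x) (disj (x * f s)).
  case: (x \in A); case: (x \in D); case: (_ * _ \in A); case: (_ * _ \in D) => //= _ H1 H2;
    by [case: (H1 isT isT)|case: (H2 isT isT)].
apply: leq_sum => -[t y] _ /=; rewrite !finset.in_setU.
by case: (y \in A); case: (y \in D); case: (_ * _ \in A); case: (_ * _ \in D).
Qed.

Lemma bd_cut W E : E \subset W ->
  (forall x s, x \in W -> x * f s \in W -> (x \in E) = (x * f s \in E)) ->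
  (bd E + bd (W :\: E) = bd W)%N.
Proof.
move=> /fintype.subsetP EW cE; rewrite !bd_pair -!big_split /=.
apply: eq_bigr => -[s x] _ /=; rewrite /crosses !finset.in_setD.
move: (cE x s) (EW x) (EW (x * f s)).
case: (x \in W); case: (_ * _ \in W); case: (x \in E); case: (_ * _ \in E) => //= H1 H2 H3;
  by [have := H1 isT isT|have := H2 isT|have := H3 isT].
Qed.

Hypothesis f_gen : forall x, exists w, ev f w = x.

Lemma bd_edge A : A != finset.set0 -> A != [set: Q]%SET ->
  exists x s, (x \in A) && (x * f s \notin A) || (x \notin A) && (x * f s \in A).
Proof.
move=> A0 AT; apply: contrapT => noedge.
have inv x w : (x \in A) = (x * ev f w \in A).
  apply: (@stays_cut _ _ f [set: Q]%SET A x w) => [y s _ _|].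
    have [yA|yA] := boolP (y \in A); have [ysA|ysA] := boolP (y * f s \in A) => //.
    - by case: noedge; exists y, s; rewrite yA ysA.
    - by case: noedge; exists y, s; rewrite yA ysA orbT.
  by apply: stays_prefix => u v _; rewrite finset.in_setT.
case/set0Pn: A0 => x xA; case/negP: AT; apply/eqP/finset.setP => y.
by have [w wE] := f_gen (x^-1 * y); rewrite finset.in_setT -[y](mulVKg x) -wE -inv.
Qed.

Lemma bd_gt0 A : A != finset.set0 -> A != [set: Q]%SET -> (0 < bd A)%N.
Proof.
move=> A0 AT; have [x [s xs]] := bd_edge A0 AT.
rewrite bd_pair (bigD1 (s, x)) //= addn_gt0 /crosses; apply/orP; left.
by move: xs; case: (x \in A); case: (_ \in A).
Qed.

(** The sets over which the Cheeger constant is an infimum. *)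
Definition admissible A : bool := (0 < #|A|)%N && (2 * #|A| <= #|Q|)%N.

Lemma admissible_neq0 A : admissible A -> A != finset.set0.
Proof. by case/andP; rewrite card_gt0. Qed.

Lemma admissible_neqT A : admissible A -> A != [set: Q]%SET.
Proof.
case/andP => A0 A2; apply: contraTneq A2 => AT; rewrite -ltnNge.
by move: A0; rewrite AT cardsT mul2n -addnn -{2}[#|Q|]addn0 ltn_add2l.
Qed.

(** [D] realises the Cheeger constant, and has the least size among the sets
    that do: the latter is what makes [D] and its complement connected. *)
Definition cheeger_minimal D : Prop :=
  admissible D /\ forall A, admissible A ->
    (bd D * #|A| <= bd A * #|D|)%N /\
    ((#|A| < #|D|)%N -> (bd D * #|A| < bd A * #|D|)%N).

Lemma exists_cheeger_minimal A0 : admissible A0 ->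
  exists D, cheeger_minimal D /\ (bd D * #|A0| <= bd A0 * #|D|)%N.
Proof.
move=> sA0; pose r A : rat := ((bd A)%:R / (#|A|)%:R)%R.
have rle A D : admissible A -> admissible D ->
    (r A <= r D)%R = (bd A * #|D| <= bd D * #|A|)%N.
  move=> /andP[A0' _] /andP[D0 _]; rewrite /r.
  by rewrite ler_pdivrMr ?ltr0n // mulrAC ler_pdivlMr ?ltr0n // -!natrM ler_nat.
pose D1 := [arg min_(A < A0 | admissible A) r A]%O.
have [sD1 minD1] : admissible D1 /\ forall A, admissible A -> (r D1 <= r A)%R.
  by rewrite /D1; case: Order.TotalTheory.arg_minP.
pose P A := admissible A && (bd A * #|D1| == bd D1 * #|A|)%N.
have PD1 : P D1 by rewrite /P sD1 eqxx.
have [D /andP[sD /eqP rD] minD] := arg_minnP (fun A : {set Q} => #|A|) PD1.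
have rDD1 : r D = r D1 by apply/eqP; rewrite eq_le !rle // rD leqnn.
have minr A : admissible A -> (bd D * #|A| <= bd A * #|D|)%N.
  by move=> sA; rewrite -rle // rDD1 minD1.
exists D; split; last exact: minr.
split=> // A sA; split=> [|AD]; first exact: minr.
rewrite ltn_neqAle minr // andbT; apply: contraL AD => /eqP rA.
rewrite -leqNgt; apply: minD; rewrite /P sA /=.
have : r A = r D by apply/eqP; rewrite eq_le !rle // rA leqnn.
by rewrite rDD1 => rAD; rewrite eqn_leq -!rle // rAD lexx.
Qed.

Section Minimal.
Variable D : {set Q}.
Hypothesis minD : cheeger_minimal D.

Let D0 : (0 < #|D|)%N. Proof. by case: minD => /andP[]. Qed.
Let D2 : (2 * #|D| <= #|Q|)%N. Proof. by case: minD => /andP[]. Qed.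

Let D_neq0 : D != finset.set0.
Proof. by apply: admissible_neq0; case: minD. Qed.

Let D_neqT : D != [set: Q]%SET.
Proof. by apply: admissible_neqT; case: minD. Qed.

(** Were [D] at most a quarter of [Q], its union with a translate that contains the
    outer end of one of its boundary edges would be admissible. By submodularity the
    union or the intersection would then contradict the minimality of [D]. *)
Lemma minimal_large : (#|Q| < 4 * #|D|)%N.
Proof.
rewrite ltnNge; apply/negP => D4.
have [x [s xs]] := bd_edge D_neq0 D_neqT.
pose a := if x \in D then x else x * f s; pose b := if x \in D then x * f s else x.
have [aD bD] : a \in D /\ b \notin D.
  by move: xs; rewrite /a /b; case: (boolP (x \in D)) => xD /=; rewrite ?orbF.
pose g := b * a^-1; pose D' := (g *: D).
have bD' : b \in D' by rewrite mem_lcoset /g invgM invgK mulgVK.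
have cD' : #|D'| = #|D| by exact: card_lcoset.
have IU := cardsUI D D'; rewrite cD' in IU.
have sub := bd_submodular D D'; rewrite /D' bd_translate -/D' in sub.
have Uc : (#|D :|: D'| <= 2 * #|D|)%N by rewrite mul2n -addnn -IU leq_addr.
have sU : admissible (D :|: D').
  apply/andP; split; first by rewrite (leq_trans D0) // subset_leq_card // finset.subsetUl.
  by rewrite (leq_trans _ D4) // -[4]/(2 * 2)%N -mulnA leq_mul2l.
have ltI : (#|D :&: D'| < #|D|)%N.
  apply: proper_card; rewrite properE subsetIl /=; apply/negP => /fintype.subsetP DI.
  have DD' : D = D'.
    apply/eqP; rewrite eqEcard cD' leqnn andbT.
    by apply/fintype.subsetP => y /DI; rewrite finset.in_setI => /andP[].
  by move: bD; rewrite DD' bD'.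
have [minU _] := (minD.2 _ sU).
have [I0|I0] := eqVneq (D :&: D') finset.set0.
  have := bd_disjoint_edge I0 (x := x) (s := s); rewrite /D' bd_translate -/D' => edge.
  have {edge} : (bd (D :|: D') < bd D + bd D)%N.
    apply: edge; move: aD bD'; rewrite /a /b.
    by case: (x \in D) => /= [_|->] ->; rewrite ?orbT.
  rewrite I0 cards0 addn0 in IU; rewrite IU in minU.
  by move=> edge; nia.
have sI : admissible (D :&: D').
  by rewrite /admissible card_gt0 I0 (leq_trans _ D2) // leq_mul2l ltnW.
have := (minD.2 _ sI).2 ltI => ltI'.
move: IU sub ltI' minU; move: (bd (_ :|: _)) (bd (_ :&: _)) => u i.
move: #|_ :|: _| #|_ :&: _| => nu ni IU sub ltI' minU.
have := leq_add ltI' minU; rewrite addSn -mulnDr -mulnDl [(ni + nu)%N]addnC IU.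
by move=> H; have := leq_mul sub (leqnn #|D|); lia.
Qed.

(** If [D] fell into two parts without edges between them, one of the parts would be
    smaller than [D] and have at most the same ratio. *)
Lemma minimal_connected : cut_connected f D.
Proof.
move=> E ED E0 cE; apply: contrapT => /eqP EnD.
have bdE := bd_cut ED cE.
have cED : (#|E| + #|D :\: E| = #|D|)%N.
  by rewrite -(cardsID E D) (finset.setIidPr ED).
have E0' : (0 < #|E|)%N by rewrite card_gt0.
have F0' : (0 < #|D :\: E|)%N.
  by rewrite card_gt0; apply: contra EnD; rewrite finset.setD_eq0 finset.eqEsubset ED.
have [sE sF] : admissible E /\ admissible (D :\: E) by split; apply/andP; split=> //; lia.
have [_ ltE] := minD.2 _ sE; have [_ ltF] := minD.2 _ sF.
have {}ltE := ltE ltac:(lia); have {}ltF := ltF ltac:(lia).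
nia.
Qed.

(** Suppose that the complement is the union of [E] and [F] without edges between
    them. If both are admissible, one of them has a lower ratio than [D], or the same
    ratio and fewer elements; otherwise adding the smaller one to [D] gives an
    admissible set with a lower ratio. *)
Lemma minimal_co_connected : cut_connected f (~: D)%SET.
Proof.
have split E F : E :&: F = finset.set0 -> E :|: F = (~: D)%SET ->
    (0 < #|E|)%N -> (0 < #|F|)%N ->
    (bd E + bd F = bd D)%N -> (2 * #|E| <= #|Q|)%N -> False.
  move=> EF0 EF E0 F0 bdEF E2.
  have cQ : (#|E| + #|F| + #|D| = #|Q|)%N.
    by rewrite -cardsUI EF0 cards0 addn0 EF addnC cardsC.
  have sE : admissible E by rewrite /admissible E0.
  have [leE ltE] := minD.2 _ sE; have bdD := bd_gt0 D_neq0 D_neqT.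
  have [F2|F2] := leqP (2 * #|F|)%N #|Q|.
    have [leF ltF] := minD.2 F (introT andP (conj F0 F2)).
    have DEF : (#|D| <= #|E| + #|F|)%N by move: D2; lia.
    have eqD : (bd E * #|D| + bd F * #|D| = bd D * #|D|)%N by rewrite -mulnDl bdEF.
    have leD : (#|D| <= #|E|)%N.
      rewrite leqNgt; apply/negP => /ltE {}ltE.
      by have := leq_mul (leqnn (bd D)) DEF; rewrite mulnDr; lia.
    have : (bd D * (#|E| + #|F|) <= bd D * #|D|)%N by rewrite mulnDr; lia.
    by rewrite leq_pmul2l //; lia.
  have bdE : (0 < bd E)%N.
    apply: bd_gt0; first by rewrite -card_gt0.
    apply: contraTneq F0 => ET; rewrite -leqNgt; move: cQ.
    rewrite ET cardsT -addnA -[RHS]addn0 => /addnI/eqP.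
    by rewrite addn_eq0 => /andP[/eqP-> _].
  have cF : #|(~: F)%SET| = (#|E| + #|D|)%N.
    by apply/eqP; rewrite -(eqn_add2l #|F|) cardsC -cQ addnA [(#|F| + _)%N]addnC.
  have sDE : admissible (~: F)%SET by rewrite /admissible cF; apply/andP; split; lia.
  have [leDE _] := minD.2 _ sDE; rewrite bdC in leDE.
  by rewrite cF in leDE; nia.
move=> E ED E0 cE; apply: contrapT => /eqP EnD.
have bdE := bd_cut ED cE; rewrite bdC in bdE.
pose F := (~: D)%SET :\: E.
have E0' : (0 < #|E|)%N by rewrite card_gt0.
have F0' : (0 < #|F|)%N.
  by rewrite card_gt0; apply: contra EnD; rewrite finset.setD_eq0 finset.eqEsubset ED.
have EF0 : E :&: F = finset.set0.
  apply/finset.setP => x.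
  by rewrite !(finset.in_setI, finset.in_setD, inE); case: (x \in E).
have EF : E :|: F = (~: D)%SET.
  apply/finset.setP => x; rewrite finset.in_setU finset.in_setD.
  by have := fintype.subsetP ED x; case: (x \in E) => //= /(_ isT) ->.
have [E2|E2] := leqP (2 * #|E|)%N #|Q|; first exact: split EF0 EF _ _ bdE E2.
apply: (split F E) => //; rewrite ?[F :&: E]finset.setIC ?[F :|: E]finset.setUC //.
  by rewrite addnC.
have := cardsUI E F; rewrite EF0 cards0 addn0 EF; move: E2; rewrite -(cardsC D); lia.
Qed.

End Minimal.

Lemma minimal_translate g D : cheeger_minimal D -> cheeger_minimal (g *: D).
Proof. by rewrite /cheeger_minimal /admissible bd_translate card_lcoset. Qed.

Lemma short_words n : exists s : seq (word X), forall w, (size w <= n)%N -> w \in s.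
Proof.
elim: n => [|n [s sP]]; first by exists [:: [::]] => -[].
exists ([::] :: [seq l :: w | l <- enum {: X * bool}, w <- s]) => -[|l w] //= wn.
by rewrite in_cons; apply/orP; right; apply: allpairs_f; rewrite ?mem_enum ?sP.
Qed.

End Boundary.

(** A vertex gained by thickening is moved into [A] by one of finitely many words,
    whose number does not depend on [Q]. *)
Lemma card_thicken (X : finType) (n : nat) :
  exists c, forall (Q : finGroupType) (f : X -> Q) (A : {set Q}),
    (#|thicken f n A| <= #|A| + c * bd f A)%N.
Proof.
have [s sP] := short_words X n; pose s' := [seq w <- s | (size w <= n)%N].
exists (size s' * n)%N => Q f A.
rewrite -(cardsID A (thicken f n A)) leq_add //.
  by rewrite subset_leq_card // subsetIr.
have cov : (#|thicken f n A :\: A| <= \sum_(w <- s') displacement A (ev f w))%N.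
  rewrite /displacement exchange_big /= -sum1_card [leqLHS]big_mkcond /=.
  apply: leq_sum => x _.
  case: ifP => //; rewrite finset.in_setD => /andP[xA /thickenP [u [un uA]]].
  have us : u \in s' by rewrite mem_filter un sP.
  by rewrite (big_rem u) //= /crosses (negPf xA) uA.
apply: leq_trans cov _; rewrite -mulnA -sum1_size big_distrl /=.
rewrite big_seq [leqRHS]big_seq; apply: leq_sum => w; rewrite mem_filter => /andP[wn _].
by rewrite mul1n (leq_trans (displacement_ev _ _ _)) // leq_mul2r wn orbT.
Qed.

(** The constant depends only on the number of generators and on the length of the
    relators, so it is chosen before the finite quotient. *)
Lemma kernel_splits_or_small_rank (X : finType) (n : nat) : (0 < n)%N ->
  exists c, forall (G : groupType) (Q : finGroupType) (e : X -> G)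
    (q : {multiplicative G -> Q}) (D : {set Q}),
  (forall g, exists w, ev e w = g) ->
  (forall w, ev e w = 1 -> word_eq (short_relators e n) w [::]) ->
  (forall x, exists g, q g = x) ->
  admissible D -> (c * bd (q \o e) D <= #|D|)%N ->
  [\/ is_nontrivial_amalgam [set g | q g = 1], is_hnn [set g | q g = 1]
    | exists (S : {fset G}) (m : nat), [/\ generated [set` S] = [set g | q g = 1],
        (#|` S| + m <= #|X| * m + 1)%N & (4 * m <= 3 * #|Q|)%N]].
Proof.
move=> n0; have [c cP] := card_thicken X n; exists (4 * c)%N.
move=> G Q e q D e_gen e_pres q_surj sD cD; set f := q \o e in cD *.
have f_gen x : exists w, ev f w = x.
  have [g <-] := q_surj x; have [w <-] := e_gen g; exists w.
  by rewrite -(ev_hom e q).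
have [A0 [minA0 leA0]] := exists_cheeger_minimal f sD.
have [x [s xs]] := bd_edge f_gen (admissible_neq0 minA0.1) (admissible_neqT minA0.1).
pose b := if x \in A0 then x * f s else x.
have bC : b \in thicken f n A0 :&: ~: A0.
  have := thicken_edge f A0 x s n0.
  move: xs; rewrite /b !(finset.in_setI, finset.in_setC).
  have [xA|xA] /= := boolP (x \in A0).
    by rewrite orbF => -> /orP[/andP[_ ->]|].
  by move=> -> /orP[/andP[-> _]|]; rewrite ?xA.
(* The base point 1 has to lie in the intersection of the two pieces. *)
pose A := b^-1 *: A0; have minA : cheeger_minimal f A by exact: minimal_translate.
have C1 : 1 \in thicken f n A :&: ~: A.
  move: bC; rewrite !(finset.in_setI, finset.in_setC) mem_lcoset invgK mulg1.
  case/andP => /thickenP [u [un uA]] ->; rewrite andbT; apply/thickenP.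
  by exists u; rewrite mem_lcoset invgK mul1g.
have cA := minimal_connected minA; have cB := minimal_co_connected f_gen minA.
have A'Q : (4 * #|thicken f n A| <= 3 * #|Q|)%N.
  have := cP Q f A; rewrite /A bd_translate -/A card_lcoset => cA'.
  have [/andP[A0' A2] _] := minA0; have [/andP[D0 _]] := sD.
  nia.
have BQ : (4 * #|(~: A)%SET| <= 3 * #|Q|)%N.
  have lQ : (#|Q| < 4 * #|A|)%N := minimal_large f_gen minA.
  have cQ : (#|A| + #|(~: A)%SET| = #|Q|)%N := cardsC A.
  lia.
have [cC|/(disconnected_cut_hnn e_gen e_pres cA cB C1)] :=
  pselect (cut_connected f (thicken f n A :&: ~: A)); last exact: Or32.
have A'1 : 1 \in thicken f n A by move: C1; rewrite finset.in_setI => /andP[].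
have B1 : 1 \in (~: A)%SET by move: C1; rewrite finset.in_setI => /andP[].
case: (connected_cut_amalgam n0 e_gen e_pres cA cB C1 cC) => [|->|->].
- exact: Or31.
- have [S [SN cS]] := loops_rank (thicken_connected (n := n) cA) A'1.
  by apply: Or33; exists S, #|thicken f n A|.
- have [S [SN cS]] := loops_rank cB B1.
  by apply: Or33; exists S, #|(~: A)%SET|.
Qed.

(** * Restricting a sparse cut to a subgroup of finite index *)

Lemma card_sum_mem (T : finType) (B : {set T}) : #|B| = (\sum_x (x \in B))%N.
Proof.
by rewrite -sum1_card big_mkcond; apply: eq_bigr => x _; case: (x \in B).
Qed.

Lemma sum_const (T : finType) n : (\sum_(x : T) n = #|T| * n)%N.
Proof. by rewrite sum_nat_const; congr (_ * _)%N; apply: eq_card. Qed.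

Lemma exists_sum_ge (T : finType) (F : T -> nat) : (0 < #|T|)%N ->
  exists y, (\sum_x F x <= #|T| * F y)%N.
Proof.
move=> T0; apply: contrapT => no.
have lt y : ((#|T| * F y).+1 <= \sum_x F x)%N.
  by rewrite ltnNge; apply/negP => le; apply: no; exists y.
have : (\sum_y (#|T| * F y).+1 <= \sum_(y : T) \sum_x F x)%N.
  by apply: leq_sum => y _; exact: lt.
rewrite sum_const (eq_bigr (fun y => 1 + #|T| * F y)%N) // big_split /=.
by rewrite sum_const -big_distrr /= muln1 -[leqRHS]add0n leq_add2r leqNgt T0.
Qed.

Lemma exists_sum_le (T : finType) (F : T -> nat) : (0 < #|T|)%N ->
  exists y, (#|T| * F y <= \sum_x F x)%N.
Proof.
move=> T0; apply: contrapT => no.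
have lt y : ((\sum_x F x).+1 <= #|T| * F y)%N.
  by rewrite ltnNge; apply/negP => le; apply: no; exists y.
have : (\sum_(y : T) (\sum_x F x).+1 <= \sum_y #|T| * F y)%N.
  by apply: leq_sum => y _; exact: lt.
by rewrite sum_const -big_distrr /= mulnS -[leqRHS]add0n leq_add2r leqNgt T0.
Qed.

Section Restriction.
Variables (G H : groupType) (Z : finGroupType) (Y X : finType).
Variables (e0 : Y -> G) (e : X -> H).
Variables (p : {multiplicative G -> Z}) (i : {multiplicative H -> G}).
Hypothesis p_surj : forall z, exists g, p g = z.
Hypothesis i_range : forall g, p g = 1 <-> exists h, i h = g.
Hypothesis e0_gen : forall g, exists w, ev e0 w = g.

Section Slices.
Variables (Q Q' : finGroupType).
Variables (q : {multiplicative G -> Q}) (q' : {multiplicative H -> Q'}).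
Hypothesis q_surj : forall x, exists g, q g = x.
Hypothesis q'_surj : forall x, exists h, q' h = x.
Hypothesis q'_ker : forall h, q' h = 1 <-> q (i h) = 1.

Let lift x : H := projT1 (cid (q'_surj x)).
(** The inclusion of [Q'] in [Q] that [i] induces. *)
Let j x : Q := q (i (lift x)).

Let jE h : j (q' h) = q (i h).
Proof.
have lh : q' (lift (q' h)) = q' h by exact: projT2 (cid (q'_surj (q' h))).
apply/divg1_eq; rewrite /j -!homV -!gmulfM; apply/q'_ker.
by rewrite gmulfM homV lh mulgV.
Qed.

Let jM x y : j (x * y) = j x * j y.
Proof.
have [h <-] := q'_surj x; have [k <-] := q'_surj y.
by rewrite -gmulfM !jE !gmulfM.
Qed.

Let j_inj : injective j.
Proof.
move=> x y; have [h <-] := q'_surj x; have [k <-] := q'_surj y.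
rewrite !jE => hk; apply/divg1_eq; rewrite -homV -gmulfM; apply/q'_ker.
by rewrite !gmulfM !homV hk mulgV.
Qed.

Variable A : {set Q}.

Definition slice y : {set Q'} := [set z | y * j z \in A]%SET.

Lemma sum_card_slice : (\sum_y #|slice y| = #|A| * #|Q'|)%N.
Proof.
rewrite (eq_bigr (fun y => \sum_z (y * j z \in A)%g)%N) => [|y _]; last first.
  by rewrite card_sum_mem; apply: eq_bigr => z _; rewrite inE.
rewrite exchange_big /= (eq_bigr (fun=> #|A|)) ?sum_const 1?mulnC // => z _.
by rewrite [RHS]card_sum_mem [RHS](reindex_inj (mulIg (j z))).
Qed.

Lemma card_quotients : (#|Q| <= #|Z| * #|Q'|)%N.
Proof.
have [s sK] := choice p_surj.
pose F (a : Z * Q') := q (s a.1) * j a.2.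
rewrite -card_prod -[#|Q|]cardsT -[leqRHS]cardsT.
apply: leq_trans (leq_imset_card F _).
apply: subset_leq_card; apply/fintype.subsetP => x _.
have [g <-] := q_surj x; have [|h hE] := (i_range ((s (p g))^-1 * g)).1.
  by rewrite gmulfM homV sK mulVg.
apply/finset.imsetP; exists (p g, q' h); rewrite ?inE //.
by rewrite /F /= jE hE -gmulfM mulVKg.
Qed.

Lemma displacement_slice y h :
  (displacement (slice y) (q' h) <= displacement A (q (i h)))%N.
Proof.
rewrite /displacement [leqRHS](reindex_inj (mulgI y)) /=.
pose F x := crosses A (y * x) (q (i h)).
have -> : (\sum_x crosses (slice y) x (q' h) = \sum_(x in j @: [set: Q']%SET) F x)%N.
  rewrite big_imset /=; last by move=> x x' _ _; exact: j_inj.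
  apply: eq_big => [x|x _]; first by rewrite finset.in_setT.
  by rewrite /crosses !inE jM jE mulgA.
by rewrite big_mkcond /=; apply: leq_sum => x _; case: ifP.
Qed.

(** Conjugation by [g] permutes the image of [H], as [H] is normal, so a slice and
    its shift by [g] differ in at most as many elements as [g] moves across [A]. *)
Lemma card_slice_shift y g :
  (#|slice y| <= #|slice (y * q g)%g| + displacement A (q g))%N.
Proof.
have conjP z : exists z', j z' = q g * j z * (q g)^-1.
  have [h <-] := q'_surj z.
  have [|h' h'E] := (i_range (g * i h * g^-1)).1.
    by rewrite !gmulfM homV ((i_range (i h)).2 (ex_intro _ h erefl)) mulg1 mulgV.
  by exists (q' h'); rewrite !jE h'E !gmulfM homV.
have [phi phiE] := choice conjP.
have phi_inj : injective phi.
  by move=> z z' /(congr1 j); rewrite !phiE => /mulIg/mulgI/j_inj.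
pose D1 := [set z | y * j z * q g \in A]%SET.
have -> : #|slice (y * q g)%g| = #|D1|.
  rewrite -(card_preimset D1 phi_inj); apply: eq_card => z.
  by rewrite !inE phiE !mulgA mulgVK.
rewrite -(cardsID D1 (slice y)) leq_add //; first by rewrite subset_leq_card // subsetIr.
rewrite card_sum_mem /displacement [leqRHS](reindex_inj (mulgI y)) /=.
pose F x := crosses A (y * x) (q g).
apply: (@leq_trans (\sum_(x in j @: [set: Q']%SET) F x)%N); last first.
  by rewrite big_mkcond /=; apply: leq_sum => x _; case: ifP.
rewrite big_imset /=; last by move=> x x' _ _; exact: j_inj.
rewrite [leqRHS](eq_bigl predT) => [|x]; last by rewrite finset.in_setT.
apply: leq_sum => x _; rewrite finset.in_setD !inE /F /crosses.
by case: (y * j x \in A); case: (_ \in A).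
Qed.

Lemma card_slice_translate y h : #|slice (y * q (i h))%g| = #|slice y|.
Proof.
rewrite -(card_preimset (slice y) (mulgI (q' h))); apply: eq_card => z.
by rewrite !inE jM jE mulgA.
Qed.

End Slices.

(** Here [Q] is [G/N], and [Q'] is [H/(H & N)] seen as the image of [H] in [Q]. Some
    slice of the cut by a coset of that image is at least as dense as the cut, and
    some is at most as dense. If the dense one is too large to be admissible, its
    complement is used: it is not too small, since any two slices have nearly the
    same size. *)
Lemma restrict_sparse_cut (k' : nat) : exists k,
  forall (Q Q' : finGroupType) (q : {multiplicative G -> Q})
    (q' : {multiplicative H -> Q'}) (A : {set Q}),
  (forall x, exists g, q g = x) -> (forall x, exists h, q' h = x) ->
  (forall h, q' h = 1 <-> q (i h) = 1) ->
  admissible A -> (k * bd (q \o e0) A <= #|A|)%N ->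
  (#|Q| <= #|Z| * #|Q'|)%N /\
  exists D : {set Q'}, admissible D /\ (k' * bd (q' \o e) D <= #|D|)%N.
Proof.
have [s sK] := choice p_surj.
have [ws wsE] := choice (fun z : Z => e0_gen (s z)).
have [wt wtE] := choice (fun t : X => e0_gen (i (e t))).
have [l lP] := bounded_on_fin (fun z => size (ws z)).
pose c := (\sum_t size (wt t))%N.
exists (#|Z| * (k' * c + 2 * l))%N => Q Q' q q' A q_surj q'_surj q'_ker.
move=> /andP[A0 A2] kA; have nQ := card_quotients q_surj q'_surj q'_ker.
split=> //; set b := bd (q \o e0) A in kA.
have Q0 : (0 < #|Q|)%N by apply/card_gt0P; exists 1.
have Q'0 : (0 < #|Q'|)%N by apply/card_gt0P; exists 1.
have Z0 : (0 < #|Z|)%N by apply/card_gt0P; exists 1.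
pose sl := slice q q'_surj A.
have disp w : (displacement A (q (ev e0 w)) <= size w * b)%N.
  by rewrite ev_hom; exact: displacement_ev.
have bd_sl y : (bd (q' \o e) (sl y) <= c * b)%N.
  rewrite /bd /c big_distrl /=; apply: leq_sum => t _.
  apply: leq_trans (displacement_slice q'_surj q'_ker A y (e t)) _.
  by rewrite -wtE disp.
have sl_le y y' : (#|sl y| <= #|sl y'| + l * b)%N.
  have [g gE] := q_surj (y^-1 * y').
  have [|h hE] := (i_range ((s (p g))^-1 * g)).1.
    by rewrite gmulfM homV sK mulVg.
  have y'E : y' = y * q (s (p g)) * q (i h).
    by rewrite -mulgA -gmulfM hE mulVKg gE mulVKg.
  rewrite y'E /sl card_slice_translate //.
  apply: leq_trans (card_slice_shift q'_surj q'_ker A y (s (p g))) _.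
  rewrite leq_add2l -wsE (leq_trans (disp _)) // leq_mul2r lP orbT //.
have sumE := sum_card_slice q q'_surj A.
have [y ay] := exists_sum_ge (fun y => #|sl y|) Q0.
have [y' ay'] := exists_sum_le (fun y => #|sl y|) Q0.
rewrite sumE /= in ay ay'.
have le_yy' := sl_le y y'; have bdy := bd_sl y.
have ka : (#|A| <= #|Z| * #|sl y|)%N.
  rewrite -(leq_pmul2r Q'0) (leq_trans ay) // mulnAC leq_mul2r nQ orbT //.
have half : (2 * #|sl y'| <= #|Q'|)%N.
  rewrite -(leq_pmul2l Q0) mulnCA (leq_trans _ (leq_mul A2 (leqnn _))) //.
  by rewrite -mulnA leq_mul2l ay'.
have kb : ((k' * c + 2 * l) * b <= #|sl y|)%N.
  by rewrite -(leq_pmul2l Z0) mulnA (leq_trans kA).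
have kb2 : (2 * ((k' * c + 2 * l) * b) <= #|Q'|)%N.
  rewrite -(leq_pmul2l Z0) (leq_trans _ nQ) // (leq_trans _ A2) //.
  by rewrite mulnCA leq_mul2l mulnA kA.
have k'bd : (k' * bd (q' \o e) (sl y) <= k' * c * b)%N by rewrite -mulnA leq_mul2l bdy orbT.
have [small_y|large_y] := leqP (2 * #|sl y|)%N #|Q'|.
  exists (sl y); split; first by apply/andP; split=> //; lia.
  by rewrite (leq_trans k'bd) // (leq_trans _ kb) // mulnDl leq_addr.
have cC : (#|sl y| + #|(~: sl y)%SET| = #|Q'|)%N := cardsC (sl y).
exists (~: sl y)%SET; rewrite bdC; split; last by lia.
by apply/andP; split; lia.
Qed.

End Restriction.

(** * From Cheeger constants and subgroups to finite quotients *)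

Lemma finitely_presented_words (G : groupType) : finitely_presented G ->
  exists (n : nat) (Rel : set (word 'I_n)) (e : 'I_n -> G),
    [/\ finite_set Rel, forall r, Rel r -> ev e r = 1,
        forall w, ev e w = 1 -> word_eq Rel w [::] & forall g, exists w, ev e w = g].
Proof.
move=> [n [Rel [finRel [h [h_inj hT]]]]].
pose e x := h (class_of Rel [:: (x, true)]).
have hE w : h (class_of Rel w) = ev e w by rewrite class_of_ev ev_hom.
exists n, Rel, e; split=> //.
- move=> r Rr; rewrite -hE (_ : class_of Rel r = 1) ?hom1 //.
  exact/class_ofP/word_eq_rel.
- by move=> w; rewrite -hE -[RHS](hom1 h) => /h_inj /class_ofP.
- move=> g; have : range h g by rewrite hT.
  by move=> [a _ <-]; have [w ->] := class_of_surj a; exists w.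
Qed.

Lemma finite_index_rank (G : groupType) (H : set G) :
  finitely_presented G -> is_subgroup H -> is_normal H -> finite_index H ->
  exists T : {fset G}, generated [set` T] = H /\ #|` T| = rank H.
Proof.
move=> /finitely_presented_words [n [Rel [e [_ _ _ e_gen]]]] sH nH fH.
have [Z [p [p_surj pH]]] := exists_quotient sH nH fH.
have [S SH] := kernel_finitely_generated e_gen p_surj.
by apply: (@rank_attained _ _ S); rewrite SH; apply/seteqP; split=> g /pH.
Qed.

Lemma isomorphic_to_image (G H : groupType) (i : {multiplicative H -> G})
    (M : set H) (K : groupType) : injective i ->
  isomorphic_to M K -> isomorphic_to (i @` M) K.
Proof.
move=> i_inj [f [f_inj fM]].
have [|g gE] := @exists_hom K G (i \o f); first by move=> x y; rewrite /= !gmulfM.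
exists g; split=> [x y|]; first by rewrite !gE => /i_inj/f_inj.
apply/seteqP; split=> [_ [x _ <-]|_ [y + <-]].
  by rewrite gE; exists (f x) => //; rewrite -fM; exists x.
by rewrite -fM => -[x _ <-]; exists x => //; rewrite gE.
Qed.

Lemma generated_image (G H : groupType) (i : {multiplicative H -> G}) (S : {fset H}) :
  generated [set` [fset i x | x in S]%fset] = i @` generated [set` S].
Proof.
have -> : [set` [fset i x | x in S]%fset] = range (i \o (val : S -> H)).
  apply/seteqP; split=> [_ /= /imfsetP [x xS ->]|_ [x _ <-]] /=.
    by exists [` xS]%fset.
  by apply/imfsetP; exists (val x) => //; exact: valP.
rewrite generated_range -range_fset_val generated_range.
apply/seteqP; split=> [_ [w _ <-]|_ [_ [w _ <-] <-]].
  by exists (ev val w); [exists w|rewrite ev_hom].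
by exists w => //; rewrite ev_hom.
Qed.

Lemma mulset_coset (G : groupType) (N : set G) g h :
  is_subgroup N -> is_normal N ->
  mulset (coset_by N g) (coset_by N h) = coset_by N (g * h).
Proof.
move=> [N1 NM NV] nN; apply/seteqP; split.
- move=> _ [_ [_ -> [m Nm <-]] [_ [_ -> [n Nn <-]] <-]].
  exists (g * h) => //; exists (m ^ h * n); first by apply: (NM) => //; exact: nN.
  by rewrite conjgE !mulgA mulgK.
- move=> _ [_ -> [n Nn <-]]; exists g; first by exists g => //; exists 1; rewrite ?mulg1.
  exists (h * n); last by rewrite mulgA.
  by exists h => //; exists n.
Qed.

(** Elements of [S] with the same image give the same edges of [cayley_quotient], so
    the boundary bounds the displacement by each [s] but not their sum. *)
Lemma small_cheeger_cut (R : realType) (G : groupType) (N : set G) (S : {fset G})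
    (Q : finGroupType) (q : {multiplicative G -> Q}) (k : nat) :
  is_subgroup N -> is_normal N ->
  (forall x, exists g, q g = x) -> (forall g, N g <-> q g = 1) -> (0 < k)%N ->
  (cheeger R (cayley_quotient S N) < (k%:R^-1)%:E)%E ->
  exists A : {set Q}, admissible A /\
    forall s, s \in S -> (k * displacement A (q s) <= #|A|)%N.
Proof.
move=> sN nN q_surj qN k0.
have qE g h : q g = q h <-> N (g^-1 * h).
  rewrite qN gmulfM homV; split=> [->|/(congr1 (mulg (q g)))]; first by rewrite mulVg.
  by rewrite mulVKg mulg1.
have [s0 sK] := choice q_surj.
pose c x := coset_by N (s0 x).
have cE g : c (q g) = coset_by N g by apply/(coset_by_eq sN)/qE; rewrite sK.
have c_inj : injective c by move=> x y /(coset_by_eq sN)/qE; rewrite !sK.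
have cosetsE : cosets N = [set` [fset c x | x : Q]%fset].
  apply/seteqP; split=> [_ [g _ <-]|_ /= /imfsetP [x _ ->]]; last by exists (s0 x).
  by apply/imfsetP; exists (q g).
have fN : finite_set (cosets N) by rewrite cosetsE; exact: finite_fset.
have cardQ : #|` fset_set (cosets N)| = #|Q|.
  by rewrite cosetsE set_fsetK card_imfset // -cardE.
move=> /ereal_inf_lt [_ [F [/= FN F0 F2] <-]].
set X := cayley_quotient S N; rewrite lte_fin => ltF.
pose A := [set x | c x \in F]%SET.
have cardA : #|A| = #|` F|.
  have -> : F = [fset c x | x in A]%fset.
    apply/fsetP => C; apply/idP/imfsetP => [CF|[x /= + ->]]; last by rewrite inE.
    have /= := FN C CF; rewrite cosetsE => /imfsetP [x _ Cx].
    by exists x => //=; rewrite inE -Cx.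
  by rewrite card_imfset //= -cardE.
exists A; split; first by rewrite /admissible cardA F0 -cardQ.
move=> s sS.
have fB : finite_set (@boundary X F).
  apply: (@sub_finite_set _ _ (cosets N `*` [set coset_by N t | t in [set` S]])).
    by move=> [C E] [/= [CN CE] _]; split.
  by apply: finite_setX => //; apply: finite_image; exact: finite_fset.
have dB : (displacement A (q s) <= #|` fset_set (@boundary X F)|)%N.
  pose B := [set x | crosses A x (q s)]%SET.
  have -> : displacement A (q s) = #|B|.
    rewrite /displacement -sum1_card [RHS]big_mkcond /=; apply: eq_bigr => x _.
    by rewrite inE; case: crosses.
  have inj : injective (fun x => (c x, coset_by N s)) by move=> x y [/c_inj].
  have -> : #|B| = #|` [fset (c x, coset_by N s) | x in B]%fset|.
    by rewrite card_imfset //= -cardE.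
  apply: fsubset_leq_card; apply/fsubsetP => _ /imfsetP [x /= xB ->].
  rewrite in_fset_set // inE; split.
    by split; [exists (s0 x)|exists s].
  move: xB; rewrite inE /crosses !inE /= mulset_coset //.
  by rewrite -cE gmulfM sK.
move: ltF; rewrite ltr_pdivrMr ?ltr0n // mulrC ltr_pdivlMr ?ltr0n // -natrM ltr_nat => ltF.
by rewrite cardA (leq_trans _ (ltnW ltF)) // mulnC leq_mul2r dB orbT.
Qed.

(** * Passing to a subgroup with a smaller ratio *)

Section Descent.
Variables (R : realType) (G : groupType) (L : set (set G)).
Hypotheses (fpG : finitely_presented G) (latL : normal_lattice L).
Hypothesis not_tau : ~ property_tau R L.
Hypothesis few_split :
  finite_set (fun H : set G => L H /\ (is_nontrivial_amalgam H \/ is_hnn H)).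

Lemma not_tau_cuts : exists S : {fset G}, generated [set` S] = [set: G] /\
  forall k, (0 < k)%N ->
    exists2 N, L N & (cheeger R (cayley_quotient S N) < (k%:R^-1)%:E)%E.
Proof.
apply: contrapT => no; apply: not_tau => S ST; apply: contrapT => noeps.
apply: no; exists S; split=> // k k0; apply: contrapT => noN; apply: noeps.
exists k%:R^-1%R; split; first by rewrite invr_gt0 ltr0n.
by move=> N LN; rewrite leNgt; apply/negP => lt; apply: noN; exists N.
Qed.

(** The bound on the index of [M] rules out the finitely many members of [L] that
    split. The same bound shows that [L] has no trivial member. *)
Lemma descent (H : set G) (bound : nat) : L H ->
  exists (M : set G) (m : nat), [/\ L M, M `<=` H,
    (bound < subgroup_index M)%N, (rank M + m <= rank H * m + 1)%N
    & (4 * m * subgroup_index H <= 3 * subgroup_index M)%N].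
Proof.
move=> LH; have [sL IL] := latL; have [sH nH fH] := sL H LH.
have [n0 [Rel0 [e0 [finRel0 Rel01 Rel0_pres e0_gen]]]] := finitely_presented_words fpG.
have [Z [p [p_surj pH]]] := exists_quotient sH nH fH.
have pE g h : p g = p h <-> H (g^-1 * h).
  rewrite pH gmulfM homV; split=> [->|/(congr1 (mulg (p g)))]; first by rewrite mulVg.
  by rewrite mulVKg mulg1.
have idxH : subgroup_index H = #|Z| by have [] := subgroup_index_card sH p_surj pE.
pose Ht : groupType := subgroup_type sH.
have [i iE] : exists i : {multiplicative Ht -> G}, forall h, i h = val h.
  by have [|i iE] := @exists_hom Ht G val; [exact: valM|exists i].
have i_inj : injective i by move=> x y; rewrite !iE; exact: val_inj.
have i_range g : p g = 1 <-> exists h, i h = g.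
  rewrite -pH; split=> [Hg|[h <-]]; last by rewrite iE; exact/asboolP/(valP h).
  have Kg : subgroup_pred sH g by apply/asboolP.
  by exists (Sub g Kg); rewrite iE SubK.
have i_in h : H (i h) by apply/pH/i_range; exists h.
have [T [TH cardT]] := finite_index_rank fpG sH nH fH.
have T_in (t : T) : exists h, i h = val t.
  by apply/i_range/pH; rewrite -TH; apply: sub_generated => /=; exact: valP.
have [e eE] := choice T_in.
have e_gen h : exists w, ev e w = h.
  have := i_in h; rewrite -TH -range_fset_val generated_range => -[w _ wh].
  by exists w; apply: i_inj; rewrite ev_hom -wh; apply: eq_ev.
have [n [n_gt0 e_pres]] : exists n, (0 < n)%N /\
    forall w, ev e w = 1 -> word_eq (short_relators e n) w [::].
  apply: (kernel_presentation finRel0 Rel01 Rel0_pres e0_gen p_surj i_inj) => //.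
  - by move=> g /i_range.
  - by move=> h; apply/i_range; exists h.
have [k' kernelP] := kernel_splits_or_small_rank T n_gt0.
have [S [ST cuts]] := not_tau_cuts.
pose eS (s : S) : G := val s.
have eS_gen g : exists w, ev eS w = g.
  have : [set: G] g by []. 
  by rewrite -ST -range_fset_val generated_range => -[w _ <-]; exists w.
have [k restrict] := restrict_sparse_cut e p_surj i_range eS_gen k'.
have [b bP] := bounded_on_finite_set (@subgroup_index G) few_split.
(* The summand after k forces the index of N, hence of M, above both bounds. *)
pose K := (k + (maxn b bound).+1)%N.
have K0 : (0 < K)%N by rewrite /K addnS.
(* The factor turns a bound for each generator into one for their sum. *)
have [|N LN ltN] := cuts (K * #|` S|.+1)%N; first by rewrite muln_gt0 K0.
have [sN nN fN] := sL N LN; have [Q [q [q_surj qN]]] := exists_quotient sN nN fN.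
have [|A [sA dA]] := small_cheeger_cut sN nN q_surj qN _ ltN.
  by rewrite muln_gt0 K0.
have KA : (K * bd (q \o eS) A <= #|A|)%N.
  rewrite -(leq_pmul2l (ltn0Sn #|` S|)) /bd mulnA [X in (X * _)%N]mulnC big_distrr /=.
  apply: (@leq_trans (\sum_(s : S) #|A|)%N).
    by apply: leq_sum => s _; apply: dA; exact: valP.
  by rewrite sum_const leq_mul2r -cardfE leqnSn orbT.
have fQ_gen x : exists w, ev (q \o eS) w = x.
  have [g <-] := q_surj x; have [w <-] := eS_gen g; exists w.
  by rewrite -(ev_hom eS q).
have [|qi qiE] := @exists_hom Ht Q (q \o i); first by move=> x y; rewrite /= !gmulfM.
pose M' : set Ht := [set h | qi h = 1].
have [Q' [q' [q'_surj q'_ker]]] :=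
  exists_quotient (kernel_subgroup qi) (@kernel_normal _ _ qi) (kernel_finite_index qi).
have q'_ker' h : q' h = 1 <-> q (i h) = 1 by rewrite -q'_ker /= qiE.
have [|cardQ [D [sD kD]]] := restrict Q Q' q q' A q_surj q'_surj q'_ker' sA.
  by rewrite (leq_trans _ KA) // leq_mul2r leq_addr orbT.
pose M := H `&` N; have LM : L M by exact: IL.
have [sM nM fM] := sL M LM.
have M'M : i @` M' = M.
  apply/seteqP; split=> [_ [h hM <-]|g [Hg Ng]].
    by split=> //; apply/qN/q'_ker'/q'_ker.
  have [h hg] := (i_range g).1 ((pH g).1 Hg); exists h => //.
  by apply/q'_ker/q'_ker'; rewrite hg; exact/qN.
(* The index is multiplicative: G/M is counted by G/H and the remainder in H. *)
have idxM : subgroup_index M = (#|Z| * #|Q'|)%N.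
  have [sec secK] := choice p_surj.
  have tail g : exists h, i h = (sec (p g))^-1 * g.
    by apply/i_range; rewrite gmulfM homV secK mulVg.
  have [tl tlE] := choice tail.
  pose F g : Z * Q' := (p g, q' (tl g)).
  have [||_ ->] := @subgroup_index_card G M (Z * Q')%type F sM.
  - move=> [z x]; have [h <-] := q'_surj x; exists (sec z * i h).
    have pz : p (sec z * i h) = z.
      by rewrite gmulfM secK ((i_range (i h)).2 (ex_intro _ h erefl)) mulg1.
    by rewrite /F pz; congr (_, q' _); apply: i_inj; rewrite tlE pz mulKg.
  - move=> g h; have tgh : p g = p h -> i ((tl g)^-1 * tl h) = g^-1 * h.
      by move=> pgh; rewrite gmulfM homV !tlE pgh invgM invgK mulgA mulgK.
    split=> [[pgh qgh]|[Hgh Ngh]].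
    + split; first exact/pE.
      rewrite -tgh //; apply/qN/q'_ker'; by rewrite gmulfM homV qgh mulVg.
    + have pgh : p g = p h by apply/pE.
      have : q' ((tl g)^-1 * tl h) = 1 by apply/q'_ker'; rewrite tgh //; apply/qN.
      rewrite gmulfM homV => /(congr1 (mulg (q' (tl g)))).
      by rewrite mulVKg mulg1 /F pgh => ->.
  - by rewrite card_prod.
have bdA : (0 < bd (q \o eS) A)%N.
  exact: (bd_gt0 fQ_gen (admissible_neq0 sA) (admissible_neqT sA)).
have boundM : (maxn b bound < subgroup_index M)%N.
  rewrite idxM (leq_trans _ cardQ) // (leq_trans _ (max_card (mem A))) //.
  by rewrite (leq_trans _ KA) // (leq_trans _ (leq_pmulr _ bdA)) // leq_addl.
have nosplit : ~ (is_nontrivial_amalgam M \/ is_hnn M).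
  move=> spl; have := bP M (conj LM spl); rewrite leqNgt => /negP; apply.
  by rewrite (leq_ltn_trans _ boundM) // leq_maxl.
have M'q : [set h | q' h = 1] = M' by apply/seteqP; split=> h /q'_ker.
case: (kernelP Ht Q' e q' D e_gen e_pres q'_surj sD kD); rewrite M'q.
- move=> [P1 [P2 [P3 [j1 [j2 [? ? ? ? iso]]]]]]; case: nosplit; left.
  exists P1, P2, P3, j1, j2; split=> //; rewrite -M'M; exact: isomorphic_to_image.
- move=> [P1 [P2 [j1 [j2 [? ? iso]]]]]; case: nosplit; right.
  exists P1, P2, j1, j2; split=> //; rewrite -M'M; exact: isomorphic_to_image.
- move=> [U [m [UM' cardU mQ']]]; exists M, m; split=> //.
  + by move=> g [].
  + by rewrite (leq_ltn_trans _ boundM) // leq_maxr.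
  + have UM : generated [set` [fset i x | x in U]%fset] = M by rewrite generated_image UM'.
    have := rank_le UM; rewrite card_imfset //= => rM.
    by rewrite -cardT cardfE (leq_trans _ cardU) // leq_add2r.
  + by rewrite idxM idxH [(#|Z| * _)%N]mulnC mulnA leq_mul2r mQ' orbT.
Qed.

End Descent.

Theorem theorem1p1 (R : realType) (G : groupType) (L : set (set G)) :
  finitely_presented G ->
  normal_lattice L ->
  [\/ infinite_set (fun H : set G => L H /\ (is_nontrivial_amalgam H \/ is_hnn H)),
      property_tau R L
    | rank_gradient R L = 0%E].
Proof.
move=> fpG latL.
have [few_split|] := pselect (finite_set
  (fun H : set G => L H /\ (is_nontrivial_amalgam H \/ is_hnn H))); last exact: Or31.
have [|not_tau] := pselect (property_tau R L); first exact: Or32.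
apply: Or33; have down := descent fpG latL not_tau few_split.
pose v (H : set G) : R := (((rank H)%:R - 1) / (subgroup_index H)%:R)%R.
have idx0 H : L H -> (0 < subgroup_index H)%N.
  move=> LH; have [sL _] := latL; have [sH _ fH] := sL H LH.
  have := in_cosets fH 1; rewrite /subgroup_index cardfs_gt0 => H1.
  by apply/fset0Pn; exists (coset_by H 1).
(* A trivial member of L has no subgroup of larger index. *)
have rank_gt0 H : L H -> (0 < rank H)%N.
  move=> LH; rewrite lt0n; apply/negP => /eqP r0.
  have [sL _] := latL; have [sH nH fH] := sL H LH.
  have [T [TH]] := finite_index_rank fpG sH nH fH.
  rewrite r0 => /eqP; rewrite cardfs_eq0 => /eqP T0.
  have H1 x : H x -> x = 1.
    rewrite -TH T0 => /(_ [set 1]); apply => //.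
    by split=> [//|? ? -> ->|? ->]; rewrite ?mulg1 ?invg1.
  have [M [m [LM MH idxM _]]] := down H (subgroup_index H) LH.
  have [[M1 _ _] _ _] := sL M LM.
  have HM : M = H by apply/seteqP; split=> // x /H1 ->.
  by move: idxM; rewrite HM ltnn.
have v_ge0 H : L H -> (0 <= v H)%R.
  by move=> LH; rewrite divr_ge0 ?ler0n // subr_ge0 ler1n rank_gt0.
have v_down H : L H -> exists2 M, L M & (v M <= 3 / 4 * v H)%R.
  move=> LH; have [M [m [LM _ _ rM mM]]] := down H 0%N LH; exists M => //.
  have [iH iM] : (0 < (subgroup_index H)%:R :> R)%R /\ (0 < (subgroup_index M)%:R :> R)%R.
    by rewrite !ltr0n !idx0.
  rewrite /v mulrA ler_pdivrMr // mulrAC ler_pdivlMr //.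
  have {}rM : ((rank M)%:R + m%:R <= (rank H)%:R * m%:R + 1 :> R)%R.
    by move: rM; rewrite -(ler_nat R) !natrD natrM.
  have {}mM : (4 * m%:R * (subgroup_index H)%:R <= 3 * (subgroup_index M)%:R :> R)%R.
    by move: mM; rewrite -(ler_nat R) !natrM.
  have rH : (0 <= (rank H)%:R - 1 :> R)%R by rewrite subr_ge0 ler1n rank_gt0.
  move: iH iM rM mM rH; move: (subgroup_index H)%:R%R (subgroup_index M)%:R%R.
  by move: (rank H)%:R%R (rank M)%:R%R m%:R%R => r s t a b a0 b0 rM mM rH; nra.
apply/eqP; rewrite eq_le; apply/andP; split; last first.
  by apply: le_ereal_inf_tmp => _ [H LH <-]; rewrite lee_fin; exact: v_ge0.
have [S [_ cuts]] := not_tau_cuts not_tau.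
have [//|H0 LH0 _] := cuts 1%N.
have inf_le H : L H -> (rank_gradient R L <= (v H)%:E)%E.
  by move=> LH; apply: ereal_inf_lbound; exists H.
case E : (rank_gradient R L) (inf_le H0 LH0) => [r| |] // _.
rewrite lee_fin leNgt; apply/negP => r0.
have : (rank_gradient R L < (4 / 3 * r)%:E)%E by rewrite E lte_fin; lra.
move=> /ereal_inf_lt [_ [H LH <-]]; rewrite lte_fin -/(v H) => vH.
have [M LM vM] := v_down H LH.
by have := inf_le M LM; rewrite E lee_fin; lra.
Qed.
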